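(* Let $$S_1(t)=\sum_{i=0}^{N_1(t)}Y_{1i}+\sum_{i=0}^{N_0(t)}Y_{3i},\qquad S_2(t)=\sum_{i=0}^{N_2(t)}Y_{2i}+\sum_{i=0}^{N_0(t)}Y_{4i},\qquad t\ge0,$$ with the Poisson processes $N_0,N_1,N_2$ and claim sizes $Y_{ki}$ described in the context, and let $\lambda=\lambda_0+\lambda_1+\lambda_2$. For all $t\ge0$ the distribution of the time intersection $(S_1(t),S_2(t))$ of the bivariate process $(S_1,S_2)$ is determined via the Laplace–Stieltjes transform $$\mathbb{E}e^{-z_1S_1(t)-z_2S_2(t)}=\exp\left\{-\lambda t\left(1-\frac{\lambda_1}{\lambda}\mathbb{E}e^{-z_1Y_{11}}-\frac{\lambda_0}{\lambda}\mathbb{E}e^{-(z_1Y_{31}+z_2Y_{41})}-\frac{\lambda_2}{\lambda}\mathbb{E}e^{-z_2Y_{21}}\right)\right\}.$$ (i) If $\mathbb{E}Y_{i1}<\infty$, $i=1,2,3,4$, then $\mathbb{E}(S_1(t))=t(\lambda_1\mathbb{E}Y_{11}+\lambda_0\mathbb{E}Y_{31})$ and $\mathbb{E}(S_2(t))=t(\lambda_2\mathbb{E}Y_{21}+\lambda_0\mathbb{E}Y_{41})$; (ii) If $\mathbb{E}(Y_{i1}^2)<\infty$, $i=1,2,3,4$, then $$\mathbb{D}(S_1(t))=t\left[\lambda_1\mathbb{E}(Y_{11}^2)+\lambda_0\mathbb{E}(Y_{31}^2)\right],\qquad \mathbb{D}(S_2(t))=t\left[\lambda_2\mathbb{E}(Y_{21}^2)+\lambda_0\mathbb{E}(Y_{41}^2)\right],$$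 where $\mathbb{D}$ denotes the variance; (iii) $\mathbb{E}(S_1(t)S_2(t))=t\lambda_0\mathbb{E}(Y_{31}Y_{41})+t^2(\lambda_1\mathbb{E}Y_{11}+\lambda_0\mathbb{E}Y_{31})(\lambda_2\mathbb{E}Y_{21}+\lambda_0\mathbb{E}Y_{41})$; (iv) $\mathrm{cov}(S_1(t),S_2(t))=t\lambda_0\mathbb{E}(Y_{31}Y_{41})$; (v) The correlation $\mathrm{cor}(S_1(t),S_2(t))$ (for $t>0$) does not depend on $t$. More precisely, $$\mathrm{cor}(S_1(t),S_2(t))=\frac{\lambda_0\mathbb{E}(Y_{31}Y_{41})}{\sqrt{\left[\lambda_1\mathbb{E}(Y_{11}^2)+\lambda_0\mathbb{E}(Y_{31}^2)\right]\left[\lambda_2\mathbb{E}(Y_{21}^2)+\lambda_0\mathbb{E}(Y_{41}^2)\right]}}.$$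
   Context: $N_0,N_1,N_2$ are mutually independent homogeneous Poisson processes with parameters $\lambda_0>0$, $\lambda_1>0$, $\lambda_2>0$ respectively, and $N_0(0)=N_1(0)=N_2(0)=0$. $Y_{k0}=0$ for $k=1,2,3,4$. For any fixed $k=1,2,3,4$ the random variables $Y_{k1},Y_{k2},\dots$ are independent and identically distributed, and almost surely strictly positive. The sequences $\{Y_{ki}\}_{i=1}^\infty$ and $\{N_r(s),s\ge0\}$, $k=1,2,3,4$, $r=0,1,2$, are mutually independent. The sequences $\{Y_{1i}\}_{i=1}^\infty$, $\{Y_{2i}\}_{i=1}^\infty$ and $\{(Y_{3i},Y_{4i})\}_{i=1}^\infty$ are mutually independent. The processes $S_1$ and $S_2$ are in general dependent.
   Formalization: The pairs (Y_{3i},Y_{4i}), i≥1, are assumed i.i.d. (coordinatewise i.i.d. is not enough: Y_{4i}=Y_{3,i+1} is a counterexample); (iv) is stated for finite means and (v) for finite second moments, so that the covariance and correlation are defined. *)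

(* Defs.v *)
From HB Require Import structures.
From mathcomp Require Export all_boot all_order all_algebra finmap.
From mathcomp Require Export all_classical all_reals all_analysis.

Set Implicit Arguments.
Unset Strict Implicit.
Unset Printing Implicit Defensive.
Import Order.TTheory GRing.Theory Num.Theory.
Import numFieldNormedType.Exports.

Local Open Scope classical_set_scope.
Local Open Scope ring_scope.

Section independence.
Context {R : realType} {d : measure_display} {T : measurableType d}.
Variable P : probability T R.

(* Meant for families of sigma-algebras; the index set may be infinite, the
   product rule being required for all of its finite subfamilies. *)
Definition mutually_independent {I : choiceType} (F : I -> set (set T)) : Prop :=
  forall (J : {fset I}) (A : I -> set T),
    (forall i, i \in J -> F i (A i)) ->
    P (\bigcap_(i in [set` J]) A i) = (\prod_(i <- J) P (A i))%E.

Context {d' : measure_display} {U : measurableType d'}.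

Definition sigma_of {I : Type} (D : set I) (X : I -> T -> U) : set (set T) :=
  <<s [set X i @^-1` B | i in D & B in measurable] >>.

Definition independent_RVs {I : choiceType} (X : I -> T -> U) : Prop :=
  mutually_independent (fun i => sigma_of [set i] X).

Definition iid (X : nat -> T -> U) : Prop :=
  independent_RVs X /\
  forall i (B : set U), measurable B -> P (X i @^-1` B) = P (X 0%N @^-1` B).

End independence.

(* Only the times t >= 0 matter. Right-continuity of the integer-valued paths
   is convergence in the discrete space nat. The law of the increments is
   required for s < t only, because poisson_pmf is not a probability mass
   function at rate 0. The increment N t - N s is a subtraction of naturals,
   which is exact on the almost sure event where the path is nondecreasing. *)
Definition poisson_process {R : realType} {d : measure_display}
    {T : measurableType d} (P : probability T R) (l : R)
    (N : R -> T -> nat) : Prop :=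
  [/\ {ae P, forall w, N 0 w = 0%N},
      {ae P, forall w, forall s t, 0 <= s -> s <= t -> (N s w <= N t w)%N},
      {ae P, forall w, forall s, 0 <= s -> \forall t \near s^'+, N t w = N s w},
      (forall t : nat -> R, 0 <= t 0%N -> nondecreasing_seq t ->
         independent_RVs P (fun n w => (N (t n.+1) w - N (t n) w)%N)) &
      (forall s t k, 0 <= s -> s < t ->
         P [set w | (N t w - N s w)%N = k] =
         (poisson_pmf (l * (t - s)) k)%:E)].

(* The index 0 is included in the sum; the model has Y 0 = 0. *)
Definition random_sum {R : realType} {T : Type} (N : R -> T -> nat)
    (Y : nat -> T -> R) (t : R) (w : T) : R :=
  \sum_(0 <= i < (N t w).+1) Y i w.

Definition correlation {R : realType} {d : measure_display}
    {T : measurableType d} (P : probability T R) (X Y : T -> R) : R :=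
  fine (covariance P X Y) / Num.sqrt (fine 'V_P[X] * fine 'V_P[Y]).

(* Main.v *)
Require Import Defs.
From mathcomp Require Import measurable_realfun.
From mathcomp Require Import ring lra.

Set Implicit Arguments.
Unset Strict Implicit.
Unset Printing Implicit Defensive.
Import Order.TTheory GRing.Theory Num.Theory.
Import numFieldNormedType.Exports.

Local Open Scope classical_set_scope.
Local Open Scope ring_scope.

(** At a fixed time [t] the pair [(S1 t, S2 t)] is a bivariate compound Poisson
    sum: it is the sum of three independent blocks, one for each counting
    process, and the block of [N_k] adds up [N_k t] independent copies of a mark
    in the plane.  The marks are [(Y3, Y4)] for the common process [N0],
    [(Y1, 0)] for [N1] and [(0, Y2)] for [N2].  As [N_k t] has a Poisson law,
    everything reduces to averaging over the number of marks.

    Averaging requires that expectations factorise.  Mutual independence is a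
    product rule for events; it extends to nonnegative functions by replacing
    indicators one at a time ([expectation_prod]).  Splitting the space along the
    values of the counting variables then shows that products of functions of
    the blocks factorise, the factor of a block being the mixture of the
    expectations for a fixed number of marks
    ([expectation_random_index_prod]).

    For a fixed number [n] of i.i.d. marks,
    - the expectation of a product of [phi] over the marks is [q ^ n] with [q]
      the expectation of [phi] of one mark;
    - the expectation of a product of two sums, of [phi] and of [psi], is [n]
      times the expectation of [phi * psi] plus [n (n - 1)] times the product of
      the expectations ([iid_expectation_sumM]).
    Mixing with Poisson weights of mean [l] replaces [q ^ n] by
    [exp (- l (1 - q))], [n] by [l] and [n (n - 1)] by [l ^ 2].  The first
    replacement gives the Laplace transform ([compound_poisson_laplace]).  By the
    second one, the expectation of a product of two compound sums is the sum
    over the blocks of [l] times the expectation of [phi * psi], plus the product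
    of the means ([compound_poisson_moment]).  For the two coordinates this is
    the mixed moment, in which only the block of [N0] has a mark with
    [phi * psi] nonzero; subtracting the product of the means leaves the
    covariance, and taking the same coordinate twice gives the variances.

    The moment identities hold in the extended half-line, for functions that are
    nonnegative everywhere; the claim sizes being positive only almost surely, the
    coordinates are replaced by their absolute values
    ([ae_compound_poisson_moment]). *)

(** * Expectations of nonnegative functions *)

Section nonneg_expectation.
Local Open Scope ereal_scope.
Context {R : realType} {d : measure_display} {T : measurableType d}.
Variable P : probability T R.
Implicit Types (X Y : T -> R) (A : set T).

Lemma ge0_expectationD X Y : measurable_fun setT X -> measurable_fun setT Y ->
  (forall w, 0 <= X w)%R -> (forall w, 0 <= Y w)%R ->
  'E_P[fun w => (X w + Y w)%R] = 'E_P[X] + 'E_P[Y].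
Proof.
move=> mX mY X0 Y0; rewrite unlock -ge0_integralD//.
- by move=> w _; rewrite lee_fin.
- exact/measurable_EFinP.
- by move=> w _; rewrite lee_fin.
- exact/measurable_EFinP.
Qed.

Lemma ge0_expectationZl (k : R) X : measurable_fun setT X ->
  (forall w, 0 <= X w)%R -> (0 <= k)%R ->
  'E_P[fun w => (k * X w)%R] = k%:E * 'E_P[X].
Proof.
move=> mX X0 k0; rewrite unlock -ge0_integralZl_EFin//.
- by move=> w _; rewrite lee_fin.
- exact/measurable_EFinP.
Qed.

Lemma ge0_expectation_sum {I : Type} (s : seq I) (X : I -> T -> R) :
  (forall i, measurable_fun setT (X i)) -> (forall i w, 0 <= X i w)%R ->
  'E_P[fun w => (\sum_(i <- s) X i w)%R] = \sum_(i <- s) 'E_P[X i].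
Proof.
move=> mX X0; rewrite unlock.
under eq_integral do rewrite -sumEFin.
rewrite ge0_integral_sum// => [i|i w _]; first exact/measurable_EFinP.
by rewrite lee_fin.
Qed.

(** Total expectation along a partition of the space by the values of an
    integer-valued variable. *)
Lemma ge0_expectation_partition (N : T -> nat) X :
  (forall n, measurable (N @^-1` [set n])) ->
  measurable_fun setT X -> (forall w, 0 <= X w)%R ->
  'E_P[X] = \sum_(n <oo) 'E_P[fun w => (\1_(N @^-1` [set n]) w * X w)%R].
Proof.
move=> mN mX X0; rewrite unlock.
have cover : setT = \bigcup_n (N @^-1` [set n]).
  by apply/seteqP; split => // w _; exists (N w).
rewrite cover ge0_integral_bigcup//.
- apply: eq_eseriesr => n _; rewrite -cover integral_mkcond.
  apply: eq_integral => w _; rewrite patchE indicE.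
  by case: ifPn => _ /=; rewrite ?mul1r ?mul0r.
- by rewrite -cover; exact/measurable_EFinP.
- by move=> w _; rewrite lee_fin.
- by move=> i j _ _ [w [/= -> ->]].
Qed.

(** The factor [c] may be infinite, which is why the series is seen as an
    integral for the counting measure. *)
Lemma nneseriesZl_ereal (c : \bar R) (u : nat -> \bar R) :
  0 <= c -> (forall n, 0 <= u n) -> \sum_(n <oo) (c * u n) = c * \sum_(n <oo) u n.
Proof.
move=> c0 u0; rewrite -!ge0_integral_count//; last by move=> n; exact: mule_ge0.
by rewrite ge0_integralZl.
Qed.

Lemma ge0_expectation_prod_sums {I J : Type} (r : seq I) (s : seq J)
    (X : I -> T -> R) (Y : J -> T -> R) :
  (forall i, measurable_fun setT (X i)) -> (forall i w, 0 <= X i w)%R ->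
  (forall j, measurable_fun setT (Y j)) -> (forall j w, 0 <= Y j w)%R ->
  'E_P[fun w => ((\sum_(i <- r) X i w) * (\sum_(j <- s) Y j w))%R] =
  \sum_(i <- r) \sum_(j <- s) 'E_P[fun w => (X i w * Y j w)%R].
Proof.
move=> mX X0 mY Y0.
under [in LHS]eq_fun do rewrite mulr_suml.
rewrite ge0_expectation_sum; last 2 first.
- by move=> i; apply: measurable_funM => //; exact: measurable_sum.
- by move=> i w; rewrite mulr_ge0// sumr_ge0.
apply: eq_bigr => i _.
under [in LHS]eq_fun do rewrite mulr_sumr.
rewrite ge0_expectation_sum// => [j|j w]; first exact: measurable_funM.
by rewrite mulr_ge0.
Qed.

End nonneg_expectation.

(** * From independent events to independent functions *)

Section independence_of_functions.
Local Open Scope ereal_scope.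
Context {R : realType} {d : measure_display} {T : measurableType d}.
Variable P : probability T R.

Lemma measurable_fun_sub_sigma (G : set (set T)) d' (U : measurableType d')
    (f : T -> U) : G `<=` measurable ->
  measurable_fun setT (f : g_sigma_algebraType G -> U) -> measurable_fun setT f.
Proof.
move=> GT mf _ B mB; rewrite setTI.
have /= := mf measurableT B mB; rewrite setTI => GB.
exact: (smallest_sub (@sigma_algebra_measurable _ T) GT).
Qed.

Import HBNNSimple.

(** The factorisation passes from indicators of events to simple functions by
    linearity, and to limits of these by monotone convergence. *)
Lemma expectationM_sub_sigma (G : set (set T)) (h f : T -> R) :
    G `<=` measurable ->
    measurable_fun setT h -> (forall w, 0 <= h w)%R ->
    measurable_fun setT (f : g_sigma_algebraType G -> R) ->
    (forall w, 0 <= f w)%R ->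
    (forall A, <<s G >> A ->
      'E_P[fun w => (\1_A w * h w)%R] = P A * 'E_P[h]) ->
  'E_P[fun w => (f w * h w)%R] = 'E_P[f] * 'E_P[h].
Proof.
move=> GT mh h0 mf f0 hG.
have mf' : measurable_fun setT (EFin \o (f : g_sigma_algebraType G -> R)).
  exact/measurable_EFinP.
pose g := nnsfun_approx measurableT mf'.
have mg n : measurable_fun setT (g n : T -> R).
  exact: (measurable_fun_sub_sigma GT).
have sG A : <<s G >> A -> measurable A.
  exact: (smallest_sub (@sigma_algebra_measurable _ T) GT).
have g_cvg w : (g n w)%:E @[n --> \oo] --> (f w)%:E.
  by apply: (@cvg_nnsfun_approx _ _ _ _ measurableT _ mf') => // x _ /=;
    rewrite lee_fin.
have g_nd w : {homo (fun n => g n w) : m n / (m <= n)%N >-> (m <= n)%R}.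
  by move=> m n mn; exact/lefP/nd_nnsfun_approx.
have sGg n r : <<s G >> (g n @^-1` [set r]).
  exact: (measurable_funPTI (g n) (measurable_set1 r)).
have E_g n : 'E_P[fun w => (g n w * h w)%R] = 'E_P[g n] * 'E_P[h].
  have mgr r : @measurable _ T (g n @^-1` [set r]). exact: sG.
  have ind0 r (w : T) : (0 <= r * \1_(g n @^-1` [set r]) w)%R.
    by have := nnfun_muleindic_ge0 (g n) r w; rewrite -EFinM lee_fin.
  have mind r : measurable_fun setT (\1_(g n @^-1` [set r]) : T -> R).
    exact: measurable_indic.
  have Eg : 'E_P[g n] =
      \sum_(r \in range (g n)) 'E_P[fun w => (r * \1_(g n @^-1` [set r]) w)%R].
    rewrite unlock; under eq_integral do rewrite fimfunE -fsumEFin//.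
    rewrite ge0_integral_fsum// => r.
      by apply/measurable_EFinP; exact: measurable_funM.
    by move=> w _; rewrite lee_fin.
  have Egh : 'E_P[fun w => (g n w * h w)%R] =
      \sum_(r \in range (g n))
         'E_P[fun w => (r * \1_(g n @^-1` [set r]) w * h w)%R].
    rewrite unlock.
    under eq_integral => w _.
      rewrite EFinM fimfunE -fsumEFin// muleC ge0_mule_fsumr; last first.
        by move=> r; rewrite lee_fin.
      over.
    rewrite /= ge0_integral_fsum//.
    - by apply: eq_fsbigr => r _; apply: eq_integral => w _; rewrite muleC.
    - move=> r; apply/measurable_EFinP; apply: measurable_funM => //.
      by apply: measurable_funM => //; exact: mind.
    - by move=> r w _; rewrite lee_fin mulr_ge0.
  rewrite Eg Egh muleC ge0_mule_fsumr; last by move=> r; exact: expectation_ge0.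
  apply: eq_fsbigr => r _.
  have [r0|r0] := leP 0%R r.
    rewrite ge0_expectationZl// expectation_indic//.
    under eq_fun do rewrite -mulrA.
    rewrite ge0_expectationZl//; last 2 first.
    - by apply: measurable_funM => //; exact: mind.
    - by move=> w; rewrite mulr_ge0.
    by rewrite hG// muleA muleC.
  rewrite preimage_nnfun0//.
  under eq_fun do rewrite indic0 mulr0 mul0r.
  under [in RHS]eq_fun do rewrite indic0 mulr0.
  by rewrite expectation_cst mule0.
have Ef : 'E_P[g n] @[n --> \oo] --> 'E_P[f].
  rewrite unlock.
  rewrite (_ : (\int[P]_w (f w)%:E) = \int[P]_w limn (fun n => (g n w)%:E)).
    apply: cvg_monotone_convergence => //.
    - by move=> n; exact/measurable_EFinP.
    - by move=> n w _; rewrite lee_fin.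
    - by move=> w _ m n mn; rewrite lee_fin; exact: g_nd.
  by apply: eq_integral => w _; apply/esym/cvg_lim => //; exact: g_cvg.
have Efh : 'E_P[fun w => (g n w * h w)%R] @[n --> \oo] -->
    'E_P[fun w => (f w * h w)%R].
  rewrite unlock.
  rewrite (_ : (\int[P]_w (f w * h w)%:E) =
               \int[P]_w limn (fun n => (g n w * h w)%:E)).
    apply: cvg_monotone_convergence => //.
    - by move=> n; apply/measurable_EFinP; exact: measurable_funM.
    - by move=> n w _; rewrite lee_fin mulr_ge0.
    - by move=> w _ m n mn; rewrite lee_fin ler_wpM2r//; exact: g_nd.
  apply: eq_integral => w _; apply/esym/cvg_lim => //.
  under eq_fun do rewrite EFinM.
  by rewrite EFinM; apply: cvgeZr => //; exact: g_cvg.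
suff Efh' : 'E_P[fun w => (g n w * h w)%R] @[n --> \oo] --> 'E_P[f] * 'E_P[h].
  exact: (cvg_unique _ Efh Efh').
under eq_fun do rewrite E_g.
(* multiplication by an infinite mean is not continuous at 0, hence the
   separate treatment of a vanishing mean of [f] *)
have [finh|] := boolP ('E_P[h] \is a fin_num); first exact: cvgeZr.
rewrite ge0_fin_numE ?expectation_ge0// -leNgt leye_eq => /eqP Eh.
have [f_eq0|f_neq0] := eqVneq 'E_P[f] 0.
  rewrite f_eq0 mul0e; apply: cvg_near_cst; near=> n.
  suff -> : 'E_P[g n] = 0 by rewrite mul0e.
  apply/eqP; rewrite eq_le expectation_ge0// andbT -f_eq0.
  apply: expectation_le => //; first exact: (measurable_fun_sub_sigma GT).
  apply: aeW => w; rewrite -lee_fin /g nnsfun_approxE.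
  by apply: (@le_approx _ _ _ setT (EFin \o f)) => // x _; rewrite lee_fin.
apply: cvgeM => //; last exact: cvg_cst.
by rewrite mule_defE (negbTE f_neq0) Eh.
Unshelve. all: by end_near.
Qed.
End independence_of_functions.

Section mutual_independence.
Local Open Scope ereal_scope.
Context {R : realType} {d : measure_display} {T : measurableType d}.
Variable P : probability T R.
Context {I : choiceType} (G : I -> set (set T)).
Hypothesis G_meas : forall i, G i `<=` measurable.
Hypothesis G_indep : mutually_independent P (fun i => <<s G i >>).

Lemma sub_sigma_measurable i A : <<s G i >> A -> measurable A.
Proof. exact: (smallest_sub (@sigma_algebra_measurable _ T) (@G_meas i)). Qed.

Lemma expectation_prod_indic (s : seq I) (A : I -> set T) : uniq s ->
  (forall i, <<s G i >> (A i)) ->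
  'E_P[fun w => (\prod_(i <- s) \1_(A i) w)%R] = \prod_(i <- s) P (A i).
Proof.
move=> us GA.
have perm_s : perm_eq [fset i in s]%fset s.
  by apply: uniq_perm => // i; rewrite in_fset.
have mA : measurable (\bigcap_(i in [set` [fset i in s]%fset]) A i).
  apply: fin_bigcap_measurable => // i _.
  exact: sub_sigma_measurable (GA i).
rewrite -(perm_big _ perm_s)/= -(G_indep (fun i _ => GA i)) -expectation_indic//.
congr expectation; apply/funext => w; rewrite -(perm_big _ perm_s)/=.
rewrite indicE; case: (pselect (forall i, i \in s -> A i w)) => [Aw|nAw].
  rewrite mem_set => [|i/=]; last by rewrite in_fset; exact: Aw.
  rewrite big_seq big1// => i; rewrite in_fset => si.
  by rewrite indicE mem_set//; exact: Aw.
have /existsNP[i /not_implyP[si nAi]] := nAw.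
rewrite memNset => [|/(_ i)/=]; last by rewrite in_fset => /(_ si).
by apply/eqP; rewrite prodf_seq_eq0; apply/hasP; exists i;
  rewrite ?in_fset//= indicE memNset.
Qed.

(** The induction on [s1] turns one indicator into a function at each step: the
    statement for the indicator of an arbitrary event [B] in place of [X i] is
    the hypothesis of [expectationM_sub_sigma], and it is an instance of the
    induction hypothesis, with [i] moved to the list of the indicators. *)
Lemma expectation_prod_mixed (s1 s2 : seq I) (X : I -> T -> R)
    (A : I -> set T) : uniq (s1 ++ s2) ->
  (forall i, measurable_fun setT (X i : g_sigma_algebraType (G i) -> R)) ->
  (forall i w, 0 <= X i w)%R ->
  (forall i, <<s G i >> (A i)) ->
  'E_P[fun w => ((\prod_(i <- s1) X i w) * (\prod_(i <- s2) \1_(A i) w))%R] =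
  (\prod_(i <- s1) 'E_P[X i]) * (\prod_(i <- s2) P (A i)).
Proof.
move=> us mX X0; elim: s1 => [|i s1 IH] in s2 A us * => GA.
  rewrite big_nil mul1e -expectation_prod_indic//.
  by congr expectation; apply/funext => w; rewrite big_nil mul1r.
have [/andP[is1 is2] us12] : (i \notin s1) && (i \notin s2) /\ uniq (s1 ++ s2).
  by move: us; rewrite /= mem_cat negb_or => /andP[].
rewrite big_cons -muleA -IH//.
under [in LHS]eq_fun do rewrite big_cons -mulrA.
apply: (@expectationM_sub_sigma _ _ _ P (G i)) => //.
- apply: measurable_funM; apply: measurable_prod => j _.
    exact: measurable_fun_sub_sigma (mX j).
  apply: measurable_indic; exact: sub_sigma_measurable (GA j).
- by move=> w; rewrite mulr_ge0// prodr_ge0.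
move=> B GB.
pose A' j := if j == i then B else A j.
have A's2 w : (\prod_(j <- s2) \1_(A j) w = \prod_(j <- s2) \1_(A' j) w :> R)%R.
  rewrite !big_seq; apply: eq_bigr => j js2; rewrite /A'; case: eqP => // ji.
  by move: is2; rewrite -ji js2.
have PA's2 : \prod_(j <- s2) P (A j) = \prod_(j <- s2) P (A' j).
  rewrite !big_seq; apply: eq_bigr => j js2; rewrite /A'; case: eqP => // ji.
  by move: is2; rewrite -ji js2.
have GA' j : <<s G j >> (A' j) by rewrite /A'; case: eqP => // ->.
rewrite IH// muleCA PA's2.
transitivity ('E_P[fun w => ((\prod_(j <- s1) X j w) *
    (\prod_(j <- i :: s2) \1_(A' j) w))%R]).
  congr expectation; apply/funext => w.
  by rewrite big_cons A's2 {2}/A' eqxx mulrCA.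
rewrite IH ?big_cons//; first by rewrite {1}/A' eqxx.
by rewrite -cat1s uniq_catCA.
Qed.

Lemma expectation_prod (s : seq I) (X : I -> T -> R) : uniq s ->
  (forall i, measurable_fun setT (X i : g_sigma_algebraType (G i) -> R)) ->
  (forall i w, 0 <= X i w)%R ->
  'E_P[fun w => (\prod_(i <- s) X i w)%R] = \prod_(i <- s) 'E_P[X i].
Proof.
move=> us mX X0.
have := @expectation_prod_mixed s [::] X (fun=> setT).
rewrite cats0 big_nil mule1 => <-//; last first.
  by move=> i; exact: (@measurableT _ (g_sigma_algebraType (G i))).
by congr expectation; apply/funext => w; rewrite big_nil mulr1.
Qed.

End mutual_independence.

(** * Functions evaluated at independent random indices *)

Lemma measurable_random_index {d} {T : measurableType d} {d'}
    {U : measurableType d'} (N : T -> nat) (f : nat -> T -> U) :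
  (forall n, measurable (N @^-1` [set n])) ->
  (forall n, measurable_fun setT (f n)) ->
  measurable_fun setT (fun w => f (N w) w).
Proof.
move=> mN mf _ B mB; rewrite setTI.
rewrite (_ : _ @^-1` B = \bigcup_n (N @^-1` [set n] `&` f n @^-1` B)).
  apply: bigcup_measurable => n _; apply: measurableI => //.
  by rewrite -[X in measurable X]setTI; exact: mf.
apply/seteqP; split => [w Bw|w [n _ [/= <-]]//].
by exists (N w).
Qed.

(** A block [k] carries two sigma-algebras: the left copy of [k] is for its index,
    the right one for the functions among which the index selects. *)
Section randomly_indexed_product.
Local Open Scope ereal_scope.
Context {R : realType} {d : measure_display} {T : measurableType d}.
Variable P : probability T R.
Context {K : choiceType} (G : K + K -> set (set T)).
Hypothesis G_meas : forall i, G i `<=` measurable.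
Hypothesis G_indep : mutually_independent P (fun i => <<s G i >>).
Variable M : K -> T -> nat.
Hypothesis M_meas : forall k n, <<s G (inl k) >> (M k @^-1` [set n]).

Let mM k n : measurable (M k @^-1` [set n]).
Proof. exact: (sub_sigma_measurable G_meas (@M_meas k n)). Qed.

Definition index_mixture (k : K) (f : nat -> T -> R) : \bar R :=
  \sum_(n <oo) (P (M k @^-1` [set n]) * 'E_P[f n]).

Lemma index_mixture_ge0 k f : (forall n w, 0 <= f n w)%R ->
  0 <= index_mixture k f.
Proof.
by move=> f0; apply: nneseries_ge0 => n _ _; rewrite mule_ge0// expectation_ge0.
Qed.

(** For the blocks in [s2] the index is frozen to a prescribed value.  The
    induction on [s1] freezes one more index by splitting along its values; once all are
    frozen, the product is one of functions of independent sigma-algebras. *)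
Lemma expectation_random_index_mixed (f : K -> nat -> T -> R)
    (s1 s2 : seq K) (m : K -> nat) : uniq (s1 ++ s2) ->
  (forall k n, measurable_fun setT (f k n : g_sigma_algebraType (G (inr k)) -> R)) ->
  (forall k n w, 0 <= f k n w)%R ->
  'E_P[fun w => ((\prod_(k <- s1) f k (M k w) w) *
     (\prod_(k <- s2) (\1_(M k @^-1` [set m k]) w * f k (m k) w)))%R] =
  (\prod_(k <- s1) index_mixture k (f k)) *
  (\prod_(k <- s2) (P (M k @^-1` [set m k]) * 'E_P[f k (m k)])).
Proof.
move=> us mf f0; have mf' k n : measurable_fun setT (f k n).
  exact: (measurable_fun_sub_sigma (@G_meas (inr k))) (@mf k n).
elim: s1 => [|k s1 IH] in s2 m us *.
  rewrite big_nil mul1e big_split/=.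
  pose X i := match i with inl k => \1_(M k @^-1` [set m k]) | inr k => f k (m k) end.
  transitivity ('E_P[fun w => (\prod_(i <- map inl s2 ++ map inr s2) X i w)%R]).
    congr expectation; apply/funext => w.
    by rewrite big_nil mul1r big_split/= big_cat/= !big_map.
  rewrite (expectation_prod G_meas G_indep).
  - rewrite big_cat/= !big_map/=; congr (_ * _); apply: eq_bigr => k _.
    exact: expectation_indic.
  - rewrite cat_uniq !map_inj_uniq ?us ?andbT//=; last 2 first.
    + by move=> ? ? [].
    + by move=> ? ? [].
    by apply/hasPn => _ /mapP[k _ ->]; apply/negP => /mapP[].
  - move=> [k|k]; last exact: mf.
    exact: (@measurable_indic _ (g_sigma_algebraType (G (inl k))) R setT _
      (@M_meas k (m k))).
  - by move=> [k|k] w; [rewrite /X indicE|exact: f0].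
have [/andP[ks1 ks2] us12] : (k \notin s1) && (k \notin s2) /\ uniq (s1 ++ s2).
  by move: us; rewrite /= mem_cat negb_or => /andP[].
rewrite (@ge0_expectation_partition _ _ _ _ (M k))//; last 2 first.
- apply: measurable_funM; apply: measurable_prod => j _.
    exact: measurable_random_index.
  by apply: measurable_funM => //; exact: measurable_indic.
- by move=> w; rewrite mulr_ge0// prodr_ge0// => j _; rewrite mulr_ge0.
rewrite big_cons -muleA muleC -nneseriesZl_ereal; last 2 first.
- rewrite mule_ge0// prode_ge0// => j _; first exact: index_mixture_ge0.
  by rewrite mule_ge0// expectation_ge0.
- by move=> n; rewrite mule_ge0// expectation_ge0.
apply: eq_eseriesr => n _.
pose m' j := if j == k then n else m j.
have m's2 j : j \in s2 -> m' j = m j.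
  by rewrite /m'; case: eqP => // -> ks2'; move: ks2; rewrite ks2'.
transitivity ('E_P[fun w => ((\prod_(j <- s1) f j (M j w) w) *
   (\prod_(j <- k :: s2) (\1_(M j @^-1` [set m' j]) w * f j (m' j) w)))%R]).
  congr expectation; apply/funext => w.
  rewrite !big_cons {1 2}/m' eqxx.
  have -> : (\prod_(j <- s2) (\1_(M j @^-1` [set m' j]) w * f j (m' j) w) =
      \prod_(j <- s2) (\1_(M j @^-1` [set m j]) w * f j (m j) w) :> R)%R.
    by apply: eq_big_seq => j /m's2 ->.
  rewrite indicE; case: (pselect (M k w = n)) => Mn.
    by rewrite mem_set// !mul1r Mn -!mulrA mulrCA.
  by rewrite memNset// !(mul0r, mulr0).
rewrite IH; last by rewrite -cat1s uniq_catCA.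
rewrite big_cons {1 2}/m' eqxx.
have -> : \prod_(j <- s2) (P (M j @^-1` [set m' j]) * 'E_P[f j (m' j)]) =
    \prod_(j <- s2) (P (M j @^-1` [set m j]) * 'E_P[f j (m j)]).
  by apply: eq_big_seq => j /m's2 ->.
by rewrite muleCA muleC.
Qed.

Lemma expectation_random_index_prod (f : K -> nat -> T -> R) (s : seq K) :
  uniq s ->
  (forall k n, measurable_fun setT (f k n : g_sigma_algebraType (G (inr k)) -> R)) ->
  (forall k n w, 0 <= f k n w)%R ->
  'E_P[fun w => (\prod_(k <- s) f k (M k w) w)%R] =
  \prod_(k <- s) index_mixture k (f k).
Proof.
move=> us mf f0.
have := expectation_random_index_mixed (s1 := s) (s2 := [::]) (fun=> 0%N) _ mf f0.
rewrite cats0 big_nil mule1 => <-//.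
by congr expectation; apply/funext => w; rewrite big_nil mulr1.
Qed.

Lemma expectation_random_index k (f : nat -> T -> R) :
  (forall n, measurable_fun setT (f n : g_sigma_algebraType (G (inr k)) -> R)) ->
  (forall n w, 0 <= f n w)%R ->
  'E_P[fun w => f (M k w) w] = index_mixture k f.
Proof.
move=> mf f0.
pose F j n w := if j == k then f n w else 0%R.
have := expectation_random_index_prod (f := F) (s := [:: k]).
rewrite big_seq1 /F eqxx => <-//.
- by congr expectation; apply/funext => w; rewrite big_seq1 eqxx.
- by move=> j n; case: eqP => [->|_]; [exact: mf|exact: measurable_cst].
- by move=> j n w; case: ifP.
Qed.

Lemma expectation_random_indexM k l (f g : nat -> T -> R) : k != l ->
  (forall n, measurable_fun setT (f n : g_sigma_algebraType (G (inr k)) -> R)) ->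
  (forall n w, 0 <= f n w)%R ->
  (forall n, measurable_fun setT (g n : g_sigma_algebraType (G (inr l)) -> R)) ->
  (forall n w, 0 <= g n w)%R ->
  'E_P[fun w => (f (M k w) w * g (M l w) w)%R] =
  'E_P[fun w => f (M k w) w] * 'E_P[fun w => g (M l w) w].
Proof.
move=> kl mf f0 mg g0; rewrite !expectation_random_index//.
pose F j n w := if j == k then f n w else if j == l then g n w else 0%R.
have := expectation_random_index_prod (f := F) (s := [:: k; l]).
rewrite /= inE kl big_cons big_seq1 /F !eqxx eq_sym (negbTE kl) => <-//.
- congr expectation; apply/funext => w.
  by rewrite big_cons big_seq1 !eqxx eq_sym (negbTE kl).
- move=> j n; case: eqP => [->|_]; first exact: mf.
  by case: eqP => [->|_]; [exact: mg|exact: measurable_cst].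
- by move=> j n w; case: ifP => // _; case: ifP.
Qed.

End randomly_indexed_product.

(** * Sums and products over a fixed number of i.i.d. marks *)

Section iid_moments.
Local Open Scope ereal_scope.
Context {R : realType} {d : measure_display} {T : measurableType d}.
Variable P : probability T R.
Context {d' : measure_display} {E : measurableType d'}.

Lemma eq_law_expectation (X Y : T -> E) (phi : E -> R) :
  measurable_fun setT X -> measurable_fun setT Y ->
  (forall B, measurable B -> P (X @^-1` B) = P (Y @^-1` B)) ->
  measurable_fun setT phi -> (forall x, 0 <= phi x)%R ->
  'E_P[fun w => phi (X w)] = 'E_P[fun w => phi (Y w)].
Proof.
move=> mX mY XY mphi phi0.
pose X' : {mfun T >-> E} := mfun_Sub (mem_set mX).
pose Y' : {mfun T >-> E} := mfun_Sub (mem_set mY).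
have phiE (Z : {mfun T >-> E}) : 'E_P[fun w => phi (Z w)] =
    \int[distribution P Z]_x (phi x)%:E.
  by rewrite unlock ge0_integral_distribution//; exact/measurable_EFinP.
rewrite (phiE X') (phiE Y'); apply: eq_measure_integral => B mB _; exact: XY.
Qed.

Variable X : nat -> T -> E.
Hypothesis mX : forall i, measurable_fun setT (X i).
Hypothesis X_iid : iid P X.

Lemma iid_expectation (phi : E -> R) i :
  measurable_fun setT phi -> (forall x, 0 <= phi x)%R ->
  'E_P[fun w => phi (X i w)] = 'E_P[fun w => phi (X 0%N w)].
Proof. by move=> mphi phi0; apply: eq_law_expectation => //; exact: X_iid.2. Qed.

Lemma iid_expectation_prod (phi : nat -> E -> R) (s : seq nat) : uniq s ->
  (forall i, measurable_fun setT (phi i)) -> (forall i x, 0 <= phi i x)%R ->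
  'E_P[fun w => (\prod_(i <- s) phi i (X i w))%R] =
  \prod_(i <- s) 'E_P[fun w => phi i (X 0%N w)].
Proof.
move=> us mphi phi0.
have XT i : [set X j @^-1` B | j in [set i] & B in measurable] `<=` measurable.
  move=> _ [_ ->] [B mB <-]; rewrite -[X in measurable X]setTI; exact: mX.
rewrite (expectation_prod (X := fun i w => phi i (X i w)) XT (X_iid.1))//.
  by apply: eq_bigr => i _; exact: iid_expectation.
move=> i; apply: (measurableT_comp (mphi i)) => _ B mB; rewrite setTI.
by apply: sub_gen_smallest; exists i => //; exists B.
Qed.

Variables phi psi : E -> R.
Hypothesis mphi : measurable_fun setT phi.
Hypothesis phi0 : forall x, (0 <= phi x)%R.
Hypothesis mpsi : measurable_fun setT psi.
Hypothesis psi0 : forall x, (0 <= psi x)%R.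

Lemma iid_expectation_sum n :
  'E_P[fun w => (\sum_(i < n) phi (X i w))%R] =
  n%:R%:E * 'E_P[fun w => phi (X 0%N w)].
Proof.
rewrite ge0_expectation_sum//; last by move=> i; exact: measurableT_comp.
under eq_bigr do rewrite iid_expectation//.
by rewrite sumr_const card_ord mule_natl.
Qed.

Lemma iid_expectation_pow (q : R) n : 'E_P[fun w => phi (X 0%N w)] = q%:E ->
  'E_P[fun w => (\prod_(i < n) phi (X i w))%R] = (q ^+ n)%:E.
Proof.
move=> Eq.
have := iid_expectation_prod (phi := fun=> phi) (iota_uniq 0 (n - 0))
  (fun=> mphi) (fun=> phi0).
rewrite -/(index_iota 0 n) big_mkord Eq prodEFin prodr_const card_ord => <-.
by congr expectation; apply/funext => w; rewrite big_mkord.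
Qed.

Lemma iid_expectationM i j : i != j ->
  'E_P[fun w => (phi (X i w) * psi (X j w))%R] =
  'E_P[fun w => phi (X 0%N w)] * 'E_P[fun w => psi (X 0%N w)].
Proof.
move=> ij; pose F k := if k == i then phi else psi.
have := @iid_expectation_prod F [:: i; j].
rewrite !big_cons !big_nil /F eqxx eq_sym (negbTE ij) mule1 => <-.
- congr expectation; apply/funext => w.
  by rewrite !big_cons !big_nil eqxx eq_sym (negbTE ij) mulr1.
- by rewrite /= inE ij.
- by move=> k; case: ifP.
- by move=> k x; case: ifP.
Qed.

(** Of the [n * n] products [phi (X i) * psi (X j)], the [n] diagonal ones see
    the joint law of [phi] and [psi], the others factorise. *)
Lemma iid_expectation_sumM n :
  'E_P[fun w => ((\sum_(i < n) phi (X i w)) * (\sum_(i < n) psi (X i w)))%R] =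
  n%:R%:E * 'E_P[fun w => (phi (X 0%N w) * psi (X 0%N w))%R] +
  (n * n.-1)%:R%:E *
    ('E_P[fun w => phi (X 0%N w)] * 'E_P[fun w => psi (X 0%N w)]).
Proof.
rewrite ge0_expectation_prod_sums//; last 2 first.
- by move=> i; exact: measurableT_comp.
- by move=> i; exact: measurableT_comp.
rewrite (eq_bigr (fun=> 'E_P[fun w => (phi (X 0%N w) * psi (X 0%N w))%R] +
   n.-1%:R%:E *
   ('E_P[fun w => phi (X 0%N w)] * 'E_P[fun w => psi (X 0%N w)]))).
  rewrite sumr_const card_ord -[LHS]mule_natl ge0_muleDr.
  - by rewrite muleA -EFinM -natrM.
  - by apply: expectation_ge0 => w; rewrite mulr_ge0.
  - by rewrite !mule_ge0// expectation_ge0.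
move=> i _; rewrite (bigD1 i)//=; congr (_ + _).
  apply: (@iid_expectation (fun x => phi x * psi x)%R i).
  - exact: measurable_funM.
  - by move=> x; rewrite mulr_ge0.
rewrite (eq_bigr (fun=> 'E_P[fun w => phi (X 0%N w)] * 'E_P[fun w => psi (X 0%N w)])).
  by rewrite sumr_const cardC1 card_ord mule_natl.
by move=> j ji; rewrite iid_expectationM// eq_sym.
Qed.

End iid_moments.

(** * Generating function and factorial moments of the Poisson law *)

Section poisson_weights.
Local Open Scope ereal_scope.
Context {R : realType}.
Implicit Types l q : R.

(** Unlike the probability mass function [poisson_pmf], this expression gives
    the point mass at the origin when the mean [l] is zero. *)
Definition poisson_weight l (k : nat) : R := (l ^+ k / k`!%:R * expR (- l))%R.

Lemma poisson_weight_ge0 l k : (0 <= l)%R -> (0 <= poisson_weight l k)%R.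
Proof. by move=> l0; rewrite mulr_ge0 ?expR_ge0// divr_ge0// exprn_ge0. Qed.

Lemma nneseries_exp_coeff l : (0 <= l)%R ->
  \sum_(k <oo) (l ^+ k / k`!%:R)%:E = (expR l)%:E.
Proof.
move=> l0; rewrite expRE -EFin_lim.
  apply/congr_lim/funext => n /=; rewrite /pseries/= /series/= -sumEFin.
  by under eq_bigr do rewrite mulrC.
rewrite /pseries/=; under eq_fun do rewrite mulrC.
exact: is_cvg_series_exp_coeff.
Qed.

Lemma poisson_generating_function l q : (0 <= l)%R -> (0 <= q)%R ->
  \sum_(k <oo) ((poisson_weight l k)%:E * (q ^+ k)%:E) =
  (expR (- (l * (1 - q))))%:E.
Proof.
move=> l0 q0.
rewrite (_ : - (l * (1 - q)) = l * q + - l)%R; last by rewrite mulrBr mulr1 opprB.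
rewrite expRD EFinM muleC -(nneseries_exp_coeff (mulr_ge0 l0 q0)).
rewrite -nneseriesZl; last first.
  by move=> k _; rewrite lee_fin divr_ge0// exprn_ge0// mulr_ge0.
apply: eq_eseriesr => k _; rewrite -!EFinM; congr EFin.
by rewrite /poisson_weight exprMn; ring.
Qed.

(** The identity [E (N * f (N - 1)) = l * E (f N)] characterising the Poisson
    law, from which all factorial moments follow. *)
Lemma poisson_chen l (f : nat -> \bar R) : (0 <= l)%R -> (forall k, 0 <= f k) ->
  \sum_(k <oo) ((poisson_weight l k)%:E * (k%:R%:E * f k.-1)) =
  l%:E * \sum_(k <oo) ((poisson_weight l k)%:E * f k).
Proof.
move=> l0 f0.
have w0 k : 0 <= (poisson_weight l k)%:E by rewrite lee_fin poisson_weight_ge0.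
rewrite nneseries_recl//; last first.
  by move=> k _; rewrite mule_ge0// mule_ge0// lee_fin.
rewrite mul0e mule0 add0e -nneseries_addn; last first.
  by move=> k; rewrite mule_ge0// mule_ge0// lee_fin.
rewrite -nneseriesZl; last by move=> k _; rewrite mule_ge0.
apply: eq_eseriesr => k _; rewrite addn1/= !muleA -!EFinM; congr (_%:E * _).
rewrite /poisson_weight exprS factS natrM invfM.
field.
by rewrite nat1r !pnatr_eq0 -lt0n fact_gt0.
Qed.

Lemma poisson_mass l : (0 <= l)%R -> \sum_(k <oo) (poisson_weight l k)%:E = 1.
Proof.
move=> l0; have := poisson_generating_function l0 (@ler01 R).
rewrite subrr mulr0 oppr0 expR0 => <-.
by apply: eq_eseriesr => k _; rewrite expr1n mule1.
Qed.

Lemma poisson_mean l : (0 <= l)%R ->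
  \sum_(k <oo) ((poisson_weight l k)%:E * k%:R%:E) = l%:E.
Proof.
move=> l0; have := poisson_chen l0 (fun=> lee01).
under eq_eseriesr do rewrite mule1.
by under [in X in _ = X -> _]eq_eseriesr do rewrite mule1; rewrite poisson_mass// mule1.
Qed.

Lemma poisson_second_factorial_moment l : (0 <= l)%R ->
  \sum_(k <oo) ((poisson_weight l k)%:E * (k * k.-1)%:R%:E) = (l ^+ 2)%:E.
Proof.
move=> l0; have := @poisson_chen l (fun k => k%:R%:E) l0.
rewrite poisson_mean// -EFinM expr2 => <-; last by move=> k; rewrite lee_fin.
by apply: eq_eseriesr => k _; rewrite natrM EFinM.
Qed.

End poisson_weights.

(** * Compound Poisson sums with independent blocks *)

Section compound_poisson.
Local Open Scope ereal_scope.
Context {R : realType} {d : measure_display} {T : measurableType d}.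
Variable P : probability T R.
Context {K : finType} (G : K + K -> set (set T)).
Hypothesis G_meas : forall i, G i `<=` measurable.
Hypothesis G_indep : mutually_independent P (fun i => <<s G i >>).
Variables (M : K -> T -> nat) (l : K -> R).
Hypothesis M_meas : forall k n, <<s G (inl k) >> (M k @^-1` [set n]).
Hypothesis l_ge0 : forall k, (0 <= l k)%R.
Hypothesis M_law : forall k n,
  P (M k @^-1` [set n]) = (poisson_weight (l k) n)%:E.
Context {d' : measure_display} {E : measurableType d'}.
Variable X : K -> nat -> T -> E.
Hypothesis X_meas : forall k i,
  measurable_fun setT (X k i : g_sigma_algebraType (G (inr k)) -> E).
Hypothesis X_iid : forall k, iid P (X k).

Definition compound_sum (phi : E -> R) (w : T) : R :=
  (\sum_(k : K) \sum_(i < M k w) phi (X k i w))%R.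

Let mX k i : measurable_fun setT (X k i).
Proof. exact: (measurable_fun_sub_sigma (@G_meas (inr k))) (@X_meas k i). Qed.

Let mM k n : measurable (M k @^-1` [set n]).
Proof. exact: (sub_sigma_measurable G_meas (@M_meas k n)). Qed.

Section functional.
Variable phi : E -> R.
Hypothesis mphi : measurable_fun setT phi.
Hypothesis phi0 : forall x, (0 <= phi x)%R.

Let partial_sum k n w : R := (\sum_(i < n) phi (X k i w))%R.

Let G_partial_sum k n :
  measurable_fun setT (partial_sum k n : g_sigma_algebraType (G (inr k)) -> R).
Proof. by apply: measurable_sum => i; exact: measurableT_comp. Qed.

Let m_partial_sum k : measurable_fun setT (fun w => partial_sum k (M k w) w).
Proof.
apply: measurable_random_index => // n.
by apply: measurable_sum => i; exact: measurableT_comp.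
Qed.

Lemma measurable_compound_sum : measurable_fun setT (compound_sum phi).
Proof. exact: measurable_sum. Qed.

Lemma compound_sum_ge0 w : (0 <= compound_sum phi w)%R.
Proof. by apply: sumr_ge0 => k _; apply: sumr_ge0. Qed.

Lemma compound_poisson_block_mean k :
  'E_P[fun w => (\sum_(i < M k w) phi (X k i w))%R] =
  (l k)%:E * 'E_P[fun w => phi (X k 0%N w)].
Proof.
rewrite (@expectation_random_index _ _ _ _ _ _ G_meas G_indep _ M_meas k
  (partial_sum k))//; last by move=> n w; exact: sumr_ge0.
rewrite -(poisson_mean (l_ge0 k)) [RHS]muleC -nneseriesZl_ereal.
- apply: eq_eseriesr => n _.
  by rewrite M_law (iid_expectation_sum (mX k) (X_iid k))// muleA muleC.
- by apply: expectation_ge0 => w; exact: phi0.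
- by move=> n; rewrite mule_ge0// lee_fin// poisson_weight_ge0.
Qed.

Lemma compound_poisson_mean :
  'E_P[compound_sum phi] = \sum_(k : K) ((l k)%:E * 'E_P[fun w => phi (X k 0%N w)]).
Proof.
rewrite ge0_expectation_sum//; last by move=> k w; exact: sumr_ge0.
by apply: eq_bigr => k _; exact: compound_poisson_block_mean.
Qed.

(** A product over the marks turns into a power of [q k] given the number of
    marks, hence into the generating function of the Poisson law. *)
Lemma compound_poisson_laplace (q : K -> R) :
  (forall k, 'E_P[fun w => phi (X k 0%N w)] = (q k)%:E) ->
  'E_P[fun w => (\prod_(k : K) \prod_(i < M k w) phi (X k i w))%R] =
  (expR (- \sum_(k : K) (l k * (1 - q k))))%:E.
Proof.
move=> Eq; have q0 k : (0 <= q k)%R by rewrite -lee_fin -Eq expectation_ge0.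
rewrite (expectation_random_index_prod (f := fun k n w =>
  (\prod_(i < n) phi (X k i w))%R) G_meas G_indep M_meas).
- rewrite -sumrN expR_sum -prodEFin; apply: eq_bigr => k _.
  rewrite -poisson_generating_function//; apply: eq_eseriesr => n _.
  by rewrite M_law (iid_expectation_pow (mX k) (X_iid k) _ _ _ (Eq k)).
- exact: index_enum_uniq.
- by move=> k n; apply: measurable_prod => i _; exact: measurableT_comp.
- by move=> k n w; exact: prodr_ge0.
Qed.

End functional.

Variables phi psi : E -> R.
Hypothesis mphi : measurable_fun setT phi.
Hypothesis phi0 : forall x, (0 <= phi x)%R.
Hypothesis mpsi : measurable_fun setT psi.
Hypothesis psi0 : forall x, (0 <= psi x)%R.

Lemma compound_poisson_block_moment k :
  'E_P[fun w => ((\sum_(i < M k w) phi (X k i w)) *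
                 (\sum_(i < M k w) psi (X k i w)))%R] =
  (l k)%:E * 'E_P[fun w => (phi (X k 0%N w) * psi (X k 0%N w))%R] +
  ((l k)%:E * 'E_P[fun w => phi (X k 0%N w)]) *
  ((l k)%:E * 'E_P[fun w => psi (X k 0%N w)]).
Proof.
have w0 n : 0 <= (poisson_weight (l k) n)%:E by rewrite lee_fin poisson_weight_ge0.
have wn0 n m : 0 <= (poisson_weight (l k) n)%:E * m%:R%:E.
  by rewrite mule_ge0// lee_fin.
have e0 : 0 <= 'E_P[fun w => (phi (X k 0%N w) * psi (X k 0%N w))%R].
  by apply: expectation_ge0 => w; rewrite mulr_ge0.
have e1 : 0 <= 'E_P[fun w => phi (X k 0%N w)] * 'E_P[fun w => psi (X k 0%N w)].
  by rewrite mule_ge0// expectation_ge0.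
rewrite (@expectation_random_index _ _ _ _ _ _ G_meas G_indep _ M_meas k
  (fun n w => (\sum_(i < n) phi (X k i w)) * (\sum_(i < n) psi (X k i w)))%R)//.
- rewrite muleACA -EFinM -expr2.
  rewrite -(poisson_second_factorial_moment (l_ge0 k)).
  rewrite -{1}(poisson_mean (l_ge0 k)).
  rewrite [X in X + _]muleC [X in _ + X]muleC.
  rewrite -!nneseriesZl_ereal//.
  rewrite -nneseriesD//; [|by move=> n *; exact: mule_ge0
    |by move=> n *; exact: mule_ge0].
  apply: eq_eseriesr => n _.
  rewrite M_law (iid_expectation_sumM (mX k) (X_iid k))//.
  rewrite ge0_muleDr; [|by apply: mule_ge0 => //; rewrite lee_fin
    |by apply: mule_ge0 => //; rewrite lee_fin].
  by congr (_ + _); rewrite muleA muleC.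
- by move=> n; apply: measurable_funM; apply: measurable_sum => i;
    exact: measurableT_comp.
- by move=> n w; rewrite mulr_ge0// sumr_ge0.
Qed.

(** Two distinct blocks are independent, so only the diagonal of the double sum
    over the blocks contributes more than the product of the means. *)
Lemma compound_poisson_moment :
  'E_P[fun w => (compound_sum phi w * compound_sum psi w)%R] =
  \sum_(k : K) ((l k)%:E * 'E_P[fun w => (phi (X k 0%N w) * psi (X k 0%N w))%R]) +
  'E_P[compound_sum phi] * 'E_P[compound_sum psi].
Proof.
have mpart (f : E -> R) : measurable_fun setT f -> forall k n, measurable_fun setT
    ((fun w => \sum_(i < n) f (X k i w))%R : g_sigma_algebraType (G (inr k)) -> R).
  by move=> mf k n; apply: measurable_sum => i; exact: measurableT_comp.
have mblock (f : E -> R) : measurable_fun setT f -> forall k,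
    measurable_fun setT (fun w => \sum_(i < M k w) f (X k i w))%R.
  move=> mf k; apply: (@measurable_random_index _ _ _ _ (M k)
    (fun n w => \sum_(i < n) f (X k i w))%R) => // n.
  by apply: measurable_sum => i; exact: measurableT_comp.
have Ef0 (f : E -> R) k : (forall x, 0 <= f x)%R ->
    0 <= (l k)%:E * 'E_P[fun w => f (X k 0%N w)].
  by move=> f0; rewrite mule_ge0 ?lee_fin// expectation_ge0.
rewrite ge0_expectation_prod_sums//; [|by move=> k; exact: mblock
  |by move=> k w; exact: sumr_ge0|by move=> k; exact: mblock
  |by move=> k w; exact: sumr_ge0].
rewrite !compound_poisson_mean// ge0_sume_distrl; last by move=> k _; exact: Ef0.
rewrite -big_split/=; apply: eq_bigr => k _.
rewrite ge0_sume_distrr; last by move=> j _; exact: Ef0.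
rewrite (bigD1 k)//= [in RHS](bigD1 k)//= addeA -compound_poisson_block_moment.
congr (_ + _); apply: eq_bigr => j jk.
rewrite -!compound_poisson_block_mean//.
apply: (@expectation_random_indexM _ _ _ _ _ _ G_meas G_indep _ M_meas k j
  (fun n w => \sum_(i < n) phi (X k i w))%R
  (fun n w => \sum_(i < n) psi (X j i w))%R) => //.
- by rewrite eq_sym.
- exact: mpart.
- by move=> n w; exact: sumr_ge0.
- exact: mpart.
- by move=> n w; exact: sumr_ge0.
Qed.

End compound_poisson.

(** * Transfer of independence *)

Section independence_transfer.
Context {R : realType} {d : measure_display} {T : measurableType d}.
Variable P : probability T R.

Lemma mutually_independent_reindex {I J : choiceType} (h : J -> I)
    (F : I -> set (set T)) : injective h ->
  mutually_independent P F -> mutually_independent P (F \o h).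
Proof.
move=> h_inj F_indep S A FA.
(* the intersection runs over at most one index, since [h] is injective; it is
   the whole space outside of the range of [h] *)
pose A' i := \bigcap_(j in [set j | h j = i]) A j.
have A'h j : A' (h j) = A j.
  rewrite /A' (_ : [set _ | _] = [set j]) ?bigcap_set1//.
  by apply/seteqP; split => [j' /= /h_inj|_ ->].
have perm_hS : perm_eq [fset h j | j in S]%fset (map h S).
  apply: uniq_perm => [||i]; first exact: fset_uniq.
    by rewrite map_inj_uniq ?fset_uniq.
  by apply/imfsetP/mapP => -[j jS ->]; exists j.
have := F_indep [fset h j | j in S]%fset A'.
rewrite (perm_big _ perm_hS) big_map/=.
have -> : (\prod_(j <- S) P (A' (h j)) = \prod_(j <- S) P (A j))%E.
  by apply: eq_bigr => j _; rewrite A'h.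
move=> <-.
- congr (P _); apply/seteqP; split => [w Aw _ /imfsetP[j jS ->]|w Aw j jS].
    by rewrite A'h; exact: Aw.
  by rewrite -A'h; apply: Aw; apply/imfsetP; exists j.
- by move=> _ /imfsetP[j jS ->]; rewrite A'h; exact: FA.
Qed.

Lemma iid_comp d1 d2 {U : measurableType d1} {V : measurableType d2}
    (X : nat -> T -> U) (g : U -> V) : measurable_fun setT g ->
  iid P X -> iid P (fun i => g \o X i).
Proof.
move=> mg [X_indep X_law].
have gB B : measurable B -> measurable (g @^-1` B).
  by move=> mB; rewrite -[X in measurable X]setTI; exact: mg.
split=> [J A gA|i B mB]; last exact: X_law (gB _ mB).
apply: X_indep => i iJ; have := gA i iJ; apply: sub_smallest2r.
  exact: smallest_sigma_algebra.
by move=> _ [_ -> [B mB <-]]; exists i => //; exists (g @^-1` B) => //; exact: gB.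
Qed.

End independence_transfer.

(** * Almost sure equality and covariance *)

Section almost_sure.
Local Open Scope ereal_scope.
Context {R : realType} {d : measure_display} {T : measurableType d}.
Variable P : probability T R.
Implicit Types X Y : T -> R.

Lemma expectation_ae_eq X Y : measurable_fun setT X -> measurable_fun setT Y ->
  {ae P, forall w, X w = Y w} -> 'E_P[X] = 'E_P[Y].
Proof.
move=> mX mY XY; rewrite unlock; apply: ae_eq_integral => //.
- exact/measurable_EFinP.
- exact/measurable_EFinP.
- by apply: filterS XY => w + _ => ->.
Qed.

Lemma probability_ae_eq (A B : set T) : measurable A -> measurable B ->
  {ae P, forall w, A w <-> B w} -> P A = P B.
Proof.
move=> mA mB AB; rewrite -!expectation_indic//; apply: expectation_ae_eq.
- exact: measurable_indic.
- exact: measurable_indic.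
- apply: filterS AB => w [AB BA]; rewrite !indicE.
  suff -> : (w \in A) = (w \in B) by [].
  by apply/idP/idP => /set_mem ?; apply/mem_set; [exact: AB|exact: BA].
Qed.

Lemma covariance_ae_eq X X' Y Y' :
  measurable_fun setT X -> measurable_fun setT X' ->
  measurable_fun setT Y -> measurable_fun setT Y' ->
  {ae P, forall w, X w = X' w} -> {ae P, forall w, Y w = Y' w} ->
  covariance P X Y = covariance P X' Y'.
Proof.
move=> mX mX' mY mY' XX' YY'.
rewrite unlock (expectation_ae_eq mX mX' XX') (expectation_ae_eq mY mY' YY').
apply: expectation_ae_eq.
- by apply: measurable_funM; apply: measurable_funB.
- by apply: measurable_funM; apply: measurable_funB.
- by apply: filterS2 XX' YY' => w XX' YY'; rewrite !fctM /= XX' YY'.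
Qed.

(** The covariance is defined as soon as the means are finite: the negative
    part of the centred product is then integrable.  When the mean of the
    product is infinite, so is the covariance. *)
Lemma ge0_covarianceE X Y :
  measurable_fun setT X -> measurable_fun setT Y ->
  (forall w, 0 <= X w)%R -> (forall w, 0 <= Y w)%R ->
  'E_P[X] < +oo -> 'E_P[Y] < +oo ->
  covariance P X Y = 'E_P[fun w => (X w * Y w)%R] - 'E_P[X] * 'E_P[Y].
Proof.
move=> mX mY X0 Y0 EX EY.
have iE (Z : T -> R) : measurable_fun setT Z -> (forall w, 0 <= Z w)%R -> 'E_P[Z] < +oo ->
    P.-integrable setT (EFin \o Z).
  move=> mZ Z0 EZ; apply/integrableP; split; first exact/measurable_EFinP.
  rewrite unlock in EZ; rewrite (le_lt_trans _ EZ)//.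
  by under eq_integral do rewrite /= ger0_norm//.
have mXY : measurable_fun setT (fun w => X w * Y w)%R by exact: measurable_funM.
have XY0 w : (0 <= X w * Y w)%R by rewrite mulr_ge0.
have iX := iE _ mX X0 EX; have iY := iE _ mY Y0 EY.
have [EXY|] := boolP ('E_P[fun w => (X w * Y w)%R] < +oo).
  have iXY := iE _ mXY XY0 EXY.
  by rewrite covarianceE//; exact/Lfun1_integrable.
rewrite -leNgt leye_eq => /eqP EXY.
have fin_EXEY : 'E_P[X] * 'E_P[Y] \is a fin_num.
  by rewrite fin_numM// ge0_fin_numE// expectation_ge0.
rewrite EXY -(fineK fin_EXEY) -EFinN addye//.
rewrite unlock; set a := fine _; set b := fine _.
set Z := ((X \- cst a) * (Y \- cst b))%R.
have a0 : (0 <= a)%R by rewrite fine_ge0// expectation_ge0.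
have b0 : (0 <= b)%R by rewrite fine_ge0// expectation_ge0.
have mZ : measurable_fun setT Z.
  by apply: measurable_funM; exact: measurable_funB.
(* an integrable upper bound of the negative part of [Z] *)
pose L w := (b * X w + a * Y w)%R.
have iL : P.-integrable setT (EFin \o L).
  have := integrableD measurableT (integrableZl measurableT b iX)
    (integrableZl measurableT a iY).
  by apply: eq_integrable.
rewrite unlock integralE.
have neg_fin : \int[P]_w (EFin \o Z)^\- w < +oo.
  apply: (@le_lt_trans _ _ (\int[P]_w (L w)%:E)).
    apply: ge0_le_integral => //.
    - exact/measurable_funeneg/measurable_EFinP.
    - by have /integrableP[] := iL.
    - move=> w _; rewrite funenegE /= -EFin_max lee_fin ge_max.
      rewrite /Z /L /= fctM /=; apply/andP; split; last by rewrite addr_ge0// mulr_ge0.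
      have := X0 w; have := Y0 w; nra.
  by have := integrable_lty measurableT iL.
(* [X * Y] is at most the sum of the positive part of [Z] and of [L] *)
suff -> : \int[P]_w (EFin \o Z)^\+ w = +oo.
  by rewrite -(@fineK _ (\int[P]_w _)) ?ge0_fin_numE ?integral_ge0.
apply/eqP; rewrite -leye_eq leNgt; apply/negP => pos_fin.
suff : 'E_P[fun w => (X w * Y w)%R] < +oo by rewrite EXY ltxx.
rewrite unlock; apply: (@le_lt_trans _ _
    (\int[P]_w ((EFin \o Z)^\+ w + (L w)%:E))).
  apply: ge0_le_integral => //.
  - by move=> w _; rewrite lee_fin.
  - exact/measurable_EFinP.
  - apply: emeasurable_funD; last by have /integrableP[] := iL.
    exact/measurable_funepos/measurable_EFinP.
  - move=> w _; rewrite funeposE /= -EFin_max -EFinD lee_fin -lerBlDr le_max.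
    apply/orP; left; rewrite /Z /L fctM /=.
    have := mulr_ge0 a0 b0; lra.
rewrite ge0_integralD//.
- by rewrite lte_add_pinfty//; exact: integrable_lty iL.
- exact/measurable_funepos/measurable_EFinP.
- by move=> w _; rewrite lee_fin addr_ge0// mulr_ge0.
- by have /integrableP[] := iL.
Qed.

End almost_sure.

(** * One-dimensional laws of a Poisson process *)

Section poisson_marginal.
Context {R : realType} {d : measure_display} {T : measurableType d}.
Variable P : probability T R.

(** As [N 0] vanishes almost surely, [N t] agrees almost surely with the increment
    from 0 to [t]; at [t = 0] this leaves the point mass at the origin. *)
Lemma poisson_process_marginal (l : R) (N : R -> {RV P >-> nat}) t n :
  0 < l -> poisson_process P l N -> 0 <= t ->
  P (N t @^-1` [set n]) = (poisson_weight (l * t) n)%:E.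
Proof.
move=> l0 [N0 _ _ _ N_incr]; rewrite le_eqVlt => /predU1P[<-|t0].
  rewrite (@probability_ae_eq _ _ _ P _ [set w | 0%N = n])//.
  - rewrite mulr0 /poisson_weight oppr0 expR0 mulr1.
    case: n => [|n].
      rewrite (_ : [set _ | _] = setT) ?probability_setT ?expr0 ?fact0 ?divr1//.
      by apply/seteqP.
    rewrite (_ : [set _ | _] = set0) ?measure0 ?expr0n/= ?mul0r//.
    by apply/seteqP; split.
  - exact: measurable_funPTI.
  - have [n0|n0] := eqVneq 0%N n.
      by rewrite (_ : [set _ | _] = setT)//; apply/seteqP; split.
    rewrite (_ : [set _ | _] = set0)//; apply/seteqP; split => // w /= /eqP.
    by rewrite (negbTE n0).
  - by apply: filterS N0 => w /= ->.
have := N_incr 0 t n (lexx 0) t0.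
rewrite subr0 /poisson_pmf mulr_gt0// => <-.
apply: probability_ae_eq.
- exact: measurable_funPTI.
- rewrite (_ : [set _ | _] = \bigcup_m (N 0 @^-1` [set m] `&`
      N t @^-1` [set k | (k - m)%N = n])); last first.
    by apply/seteqP; split => [w <-|w [m _ [/= <-]]//]; exists (N 0 w).
  by apply: bigcup_measurable => m _; apply: measurableI;
    exact: measurable_funPTI.
- by apply: filterS N0 => w /= ->; rewrite subn0.
Qed.

End poisson_marginal.

(** * Compound Poisson sums of almost surely nonnegative marks *)

Section almost_surely_nonneg.
Local Open Scope ereal_scope.
Context {R : realType} {d : measure_display} {T : measurableType d}.
Variable P : probability T R.
Implicit Types Z : T -> R.

Lemma ae_ge0_expectation_norm Z : measurable_fun setT Z ->
  {ae P, forall w, (0 <= Z w)%R} -> 'E_P[Z] = 'E_P[fun w => `|Z w|%R].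
Proof.
move=> mZ Z0; apply: expectation_ae_eq => //; first exact: measurableT_comp.
by apply: filterS Z0 => w Z0; rewrite ger0_norm.
Qed.

Lemma ae_ge0_expectation_ge0 Z : measurable_fun setT Z ->
  {ae P, forall w, (0 <= Z w)%R} -> 0 <= 'E_P[Z].
Proof.
move=> mZ Z0; rewrite ae_ge0_expectation_norm//.
by apply: expectation_ge0 => w; exact: normr_ge0.
Qed.

(** [z <= 1 + z ^ 2]. *)
Lemma expectation_lty_sqr Z : measurable_fun setT Z ->
  {ae P, forall w, (0 <= Z w)%R} ->
  'E_P[fun w => (Z w ^+ 2)%R] < +oo -> 'E_P[Z] < +oo.
Proof.
move=> mZ Z0 Z2; rewrite ae_ge0_expectation_norm//.
have mZ2 : measurable_fun setT (fun w => Z w ^+ 2)%R by exact: measurable_funX.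
apply: (@le_lt_trans _ _ 'E_P[fun w => (1 + Z w ^+ 2)%R]).
  apply: expectation_le.
  - exact: measurableT_comp.
  - exact: measurable_funD.
  - by move=> w; exact: normr_ge0.
  - by move=> w; rewrite addr_ge0// sqr_ge0.
  apply: aeW => w; rewrite -real_normK ?num_real//.
  by have := sqr_ge0 (`|Z w| - 1)%R; have := normr_ge0 (Z w); nra.
rewrite ge0_expectationD//; last by move=> w; exact: sqr_ge0.
by rewrite lte_add_pinfty// expectation_cst ltry.
Qed.

Lemma expectation_fin_num_le1 Z : measurable_fun setT Z ->
  (forall w, 0 <= Z w)%R -> {ae P, forall w, (Z w <= 1)%R} ->
  'E_P[Z] \is a fin_num.
Proof.
move=> mZ Z0 Z1; rewrite ge0_fin_numE ?expectation_ge0//.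
apply: (@le_lt_trans _ _ 'E_P[cst 1%R]); last by rewrite expectation_cst ltry.
by apply: expectation_le => // w; exact: ler01.
Qed.

End almost_surely_nonneg.

Section compound_poisson_as.
Local Open Scope ereal_scope.
Context {R : realType} {d : measure_display} {T : measurableType d}.
Variable P : probability T R.
Context {K : finType} (G : K + K -> set (set T)).
Hypothesis G_meas : forall i, G i `<=` measurable.
Hypothesis G_indep : mutually_independent P (fun i => <<s G i >>).
Variables (M : K -> T -> nat) (l : K -> R).
Hypothesis M_meas : forall k n, <<s G (inl k) >> (M k @^-1` [set n]).
Hypothesis l_ge0 : forall k, (0 <= l k)%R.
Hypothesis M_law : forall k n,
  P (M k @^-1` [set n]) = (poisson_weight (l k) n)%:E.
Context {d' : measure_display} {E : measurableType d'}.
Variable X : K -> nat -> T -> E.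
Hypothesis X_meas : forall k i,
  measurable_fun setT (X k i : g_sigma_algebraType (G (inr k)) -> E).
Hypothesis X_iid : forall k, iid P (X k).
Variables phi psi : E -> R.
Hypothesis mphi : measurable_fun setT phi.
Hypothesis phi0 : forall k i, {ae P, forall w, (0 <= phi (X k i w))%R}.
Hypothesis mpsi : measurable_fun setT psi.
Hypothesis psi0 : forall k i, {ae P, forall w, (0 <= psi (X k i w))%R}.

Let mX k i : measurable_fun setT (X k i).
Proof. exact: (measurable_fun_sub_sigma (@G_meas (inr k))) (@X_meas k i). Qed.

Let norm (f : E -> R) x : R := `|f x|%R.

Let mnorm (f : E -> R) : measurable_fun setT f -> measurable_fun setT (norm f).
Proof. by move=> mf; exact: measurableT_comp. Qed.

Let norm0 f x : (0 <= norm f x)%R.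
Proof. exact: normr_ge0. Qed.

Let S (f : E -> R) : T -> R := compound_sum M X f.

Let mS (f : E -> R) : measurable_fun setT f -> measurable_fun setT (S f).
Proof. by move=> mf; exact: (measurable_compound_sum G_meas M_meas). Qed.

Let S_norm (f : E -> R) : (forall k i, {ae P, forall w, (0 <= f (X k i w))%R}) ->
  {ae P, forall w, S f w = S (norm f) w}.
Proof.
move=> f0.
have f0' : {ae P, forall w, forall (k : K) i, (0 <= f (X k i w))%R}.
  apply: filter_forall => k; exact: ae_foralln.
apply: filterS f0' => w f0'; apply: eq_bigr => k _; apply: eq_bigr => i _.
by rewrite /norm ger0_norm.
Qed.

Lemma ae_compound_poisson_mean :
  'E_P[compound_sum M X phi] =
  \sum_(k : K) ((l k)%:E * 'E_P[fun w => phi (X k 0%N w)]).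
Proof.
rewrite (expectation_ae_eq (mS mphi) (mS (mnorm mphi)) (S_norm phi0)).
rewrite (compound_poisson_mean G_meas G_indep M_meas l_ge0 M_law X_meas
  X_iid)//; last exact: mnorm.
apply: eq_bigr => k _; congr (_ * _).
by rewrite [RHS]ae_ge0_expectation_norm//; exact: measurableT_comp.
Qed.

Lemma ae_compound_poisson_moment :
  'E_P[fun w => (compound_sum M X phi w * compound_sum M X psi w)%R] =
  \sum_(k : K) ((l k)%:E * 'E_P[fun w => (phi (X k 0%N w) * psi (X k 0%N w))%R]) +
  'E_P[compound_sum M X phi] * 'E_P[compound_sum M X psi].
Proof.
transitivity 'E_P[fun w => (S (norm phi) w * S (norm psi) w)%R].
  apply: expectation_ae_eq.
  - by apply: measurable_funM; exact: mS.
  - by apply: measurable_funM; apply: mS; exact: mnorm.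
  - by apply: filterS2 (S_norm phi0) (S_norm psi0) => w; rewrite /S => -> ->.
rewrite (expectation_ae_eq (mS mphi) (mS (mnorm mphi)) (S_norm phi0)).
rewrite (expectation_ae_eq (mS mpsi) (mS (mnorm mpsi)) (S_norm psi0)).
rewrite (compound_poisson_moment G_meas G_indep M_meas l_ge0 M_law X_meas
  X_iid)//; [|exact: mnorm|exact: mnorm].
congr (_ + _); apply: eq_bigr => k _; congr (_ * _).
rewrite [RHS]ae_ge0_expectation_norm.
- by congr expectation; apply/funext => w; rewrite normrM.
- by apply: measurable_funM; exact: measurableT_comp.
- by apply: filterS2 (phi0 k 0%N) (psi0 k 0%N) => w; exact: mulr_ge0.
Qed.

(** The means being finite, the product of the means can be subtracted from
    the mixed moment, even when the latter is infinite. *)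
Lemma ae_compound_poisson_covariance :
  'E_P[compound_sum M X phi] < +oo -> 'E_P[compound_sum M X psi] < +oo ->
  covariance P (compound_sum M X phi) (compound_sum M X psi) =
  \sum_(k : K) ((l k)%:E * 'E_P[fun w => (phi (X k 0%N w) * psi (X k 0%N w))%R]).
Proof.
move=> Ephi Epsi.
rewrite (covariance_ae_eq (mS mphi) (mS (mnorm mphi)) (mS mpsi)
  (mS (mnorm mpsi)) (S_norm phi0) (S_norm psi0)).
have Sn0 (f : E -> R) w : (0 <= S (norm f) w)%R by exact: compound_sum_ge0.
have eqphi := expectation_ae_eq (mS mphi) (mS (mnorm mphi)) (S_norm phi0).
have eqpsi := expectation_ae_eq (mS mpsi) (mS (mnorm mpsi)) (S_norm psi0).
rewrite ge0_covarianceE//; [|by apply: mS; exact: mnorm|by apply: mS; exact: mnorm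
  |by rewrite -eqphi|by rewrite -eqpsi].
have -> : 'E_P[fun w => (S (norm phi) w * S (norm psi) w)%R] =
    'E_P[fun w => (compound_sum M X phi w * compound_sum M X psi w)%R].
  apply: expectation_ae_eq.
  - by apply: measurable_funM; apply: mS; exact: mnorm.
  - by apply: measurable_funM; exact: mS.
  - by apply: filterS2 (S_norm phi0) (S_norm psi0) => w; rewrite /S => -> ->.
rewrite ae_compound_poisson_moment -eqphi -eqpsi addeK//.
rewrite fin_numM// ge0_fin_numE// ?eqphi ?eqpsi expectation_ge0//.
Qed.

End compound_poisson_as.

(** * The risk model as a compound Poisson sum with three blocks *)

Section model.
Context {R : realType} {d : measure_display} {T : measurableType d}.
Variable P : probability T R.
Variables (N0 N1 N2 : R -> {RV P >-> nat}) (Y1 Y2 Y3 Y4 : nat -> {RV P >-> R}).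

(** Block 0 belongs to the process common to both lines of business, blocks 1
    and 2 to the processes proper to the first and to the second line. *)
Definition claim_counts (t : R) (k : 'I_3) : T -> nat :=
  match val k with 0 => N0 t | 1 => N1 t | _ => N2 t end.

(** A claim of a proper process counts in one line only, whence a null coordinate;
    the first and second coordinates of the compound sum are [S1] and [S2]. *)
Definition marks (k : 'I_3) (i : nat) (w : T) : R * R :=
  match val k with
  | 0 => (Y3 i.+1 w, Y4 i.+1 w) | 1 => (Y1 i.+1 w, 0) | _ => (0, Y2 i.+1 w)
  end.

Definition count_generators (k : 'I_3) : set (set T) :=
  let N := match val k with 0 => N0 | 1 => N1 | _ => N2 end in
  [set N s @^-1` B | s in [set s : R | 0 <= s] & B in measurable].

Definition mark_generators (k : 'I_3) : set (set T) :=
  match val k with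
  | 0 => [set (fun w => (Y3 i w, Y4 i w)) @^-1` B |
           i in [set i | (1 <= i)%N] & B in measurable]
  | 1 => [set Y1 i @^-1` B | i in [set i | (1 <= i)%N] & B in measurable]
  | _ => [set Y2 i @^-1` B | i in [set i | (1 <= i)%N] & B in measurable]
  end.

Definition model_generators (c : 'I_3 + 'I_3) : set (set T) :=
  match c with inl k => count_generators k | inr k => mark_generators k end.

Lemma measurable_model_generators c : model_generators c `<=` measurable.
Proof.
have mY34 i : measurable_fun setT (fun w => (Y3 i w, Y4 i w)).
  exact: measurable_fun_pair.
case: c => -[[|[|[|//]]] ?] _ [i _ [B mB <-]] /=; try exact: measurable_funPTI.
by rewrite -[X in measurable X]setTI; exact: mY34.
Qed.

Lemma model_independent :
  mutually_independent P (tnth [tuple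
     sigma_of [set s : R | 0 <= s] N0;
     sigma_of [set s : R | 0 <= s] N1;
     sigma_of [set s : R | 0 <= s] N2;
     sigma_of [set i | (1 <= i)%N] Y1;
     sigma_of [set i | (1 <= i)%N] Y2;
     sigma_of [set i | (1 <= i)%N] (fun i w => (Y3 i w, Y4 i w))]) ->
  mutually_independent P (fun c => <<s model_generators c >>).
Proof.
(* the claim sizes of the block [k] stand three places after the counting
   process of the cyclic predecessor of [k] *)
pose position (c : 'I_3 + 'I_3) : 'I_(3 + 3) :=
  match c with inl k => lshift 3 k | inr k => rshift 3 (ord_pred k) end.
have position_inj : injective position.
  move=> [j|j] [k|k] /eqP; rewrite /position ?eq_lrshift ?eq_rlshift//.
    by rewrite eq_lshift => /eqP ->.
  by rewrite eq_rshift => /eqP /ord_pred_inj ->.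
move=> /(mutually_independent_reindex position_inj).
set F := (_ \o _); rewrite (_ : F = fun c => <<s model_generators c >>)//.
by apply/funext => -[] [[|[|[|//]]] ?].
Qed.

Lemma measurable_marks k i :
  measurable_fun setT (marks k i : g_sigma_algebraType (mark_generators k) -> R * R).
Proof.
case: k => -[|[|[|//]]] lt3; rewrite /marks /=.
- move=> _ B mB; rewrite setTI; apply: sub_gen_smallest.
  by exists i.+1 => //; exists B.
- apply/measurable_fun_pair => //; move=> _ B mB; rewrite setTI.
  by apply: sub_gen_smallest; exists i.+1 => //; exists B.
- apply/measurable_fun_pair => //; move=> _ B mB; rewrite setTI.
  by apply: sub_gen_smallest; exists i.+1 => //; exists B.
Qed.

Lemma measurable_claim_counts t k n : 0 <= t ->
  <<s count_generators k >> (claim_counts t k @^-1` [set n]).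
Proof.
move=> t0; apply: sub_gen_smallest; exists t => //; exists [set n] => //.
by rewrite /claim_counts; case: k => -[|[|[|//]]].
Qed.

Lemma marks_iid : iid P (fun i w => Y1 i.+1 w) -> iid P (fun i w => Y2 i.+1 w) ->
  iid P (fun i w => (Y3 i.+1 w, Y4 i.+1 w)) -> forall k, iid P (marks k).
Proof.
move=> Y1_iid Y2_iid Y34_iid [[|[|[|//]]] lt3] //.
- by apply: (iid_comp (X := fun i w => Y1 i.+1 w) (g := fun y : R => (y, 0 : R))).
- apply: (iid_comp (X := fun i w => Y2 i.+1 w) (g := fun y : R => (0 : R, y))) => //.
  exact: (measurable_fun_pair (f := fun=> 0 : R) (g := id)).
Qed.

End model.

Lemma random_sumE {R : realType} {T : Type} (N : R -> T -> nat)
    (Y : nat -> T -> R) t w : Y 0%N w = 0 ->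
  random_sum N Y t w = \sum_(i < N t w) Y i.+1 w.
Proof. by move=> Y0; rewrite /random_sum big_nat_recl// Y0 add0r big_mkord. Qed.

Lemma fine_pmulr {R : realType} (t : R) (x : \bar R) : 0 < t ->
  fine (t%:E * x)%E = t * fine x.
Proof.
by move=> t0; case: x => [//||]; rewrite ?gt0_muley ?gt0_muleNy ?lte_fin//= mulr0.
Qed.

Theorem corollary1 (R : realType) (d : measure_display) (T : measurableType d)
  (P : probability T R) (l0 l1 l2 : R)
  (N0 N1 N2 : R -> {RV P >-> nat}) (Y1 Y2 Y3 Y4 : nat -> {RV P >-> R})
  (l0_gt0 : 0 < l0) (l1_gt0 : 0 < l1) (l2_gt0 : 0 < l2)
  (N0_poisson : poisson_process P l0 N0)
  (N1_poisson : poisson_process P l1 N1)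
  (N2_poisson : poisson_process P l2 N2)
  (Y_0 : forall w, [/\ Y1 0%N w = 0, Y2 0%N w = 0, Y3 0%N w = 0 & Y4 0%N w = 0])
  (Y_gt0 : forall i, {ae P, forall w,
     [/\ 0 < Y1 i.+1 w, 0 < Y2 i.+1 w, 0 < Y3 i.+1 w & 0 < Y4 i.+1 w]})
  (Y1_iid : iid P (fun i w => Y1 i.+1 w))
  (Y2_iid : iid P (fun i w => Y2 i.+1 w))
  (Y34_iid : iid P (fun i w => (Y3 i.+1 w, Y4 i.+1 w)))
  (indep : mutually_independent P (tnth [tuple
     sigma_of [set s : R | 0 <= s] N0;
     sigma_of [set s : R | 0 <= s] N1;
     sigma_of [set s : R | 0 <= s] N2;
     sigma_of [set i | (1 <= i)%N] Y1;
     sigma_of [set i | (1 <= i)%N] Y2;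
     sigma_of [set i | (1 <= i)%N] (fun i w => (Y3 i w, Y4 i w))])) :
  let l := l0 + l1 + l2 in
  let S1 t w := random_sum N1 Y1 t w + random_sum N0 Y3 t w in
  let S2 t w := random_sum N2 Y2 t w + random_sum N0 Y4 t w in
  let finite_mean :=
    [/\ 'E_P[Y1 1%N] < +oo, 'E_P[Y2 1%N] < +oo,
        'E_P[Y3 1%N] < +oo & 'E_P[Y4 1%N] < +oo]%E in
  let finite_second_moment :=
    [/\ 'E_P[fun w => (Y1 1%N w ^+ 2)%R] < +oo,
        'E_P[fun w => (Y2 1%N w ^+ 2)%R] < +oo,
        'E_P[fun w => (Y3 1%N w ^+ 2)%R] < +oo &
        'E_P[fun w => (Y4 1%N w ^+ 2)%R] < +oo]%E in
  (forall t z1 z2 : R, 0 <= t -> 0 <= z1 -> 0 <= z2 ->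
     'E_P[fun w => expR (- z1 * S1 t w - z2 * S2 t w)%R]%E =
     (expR (- l * t * (1
        - l1 / l * fine 'E_P[fun w => expR (- z1 * Y1 1%N w)%R]
        - l0 / l * fine 'E_P[fun w => expR (- (z1 * Y3 1%N w + z2 * Y4 1%N w))%R]
        - l2 / l * fine 'E_P[fun w => expR (- z2 * Y2 1%N w)%R])))%:E) /\
  (* (i) *)
  (finite_mean -> forall t : R, (0 <= t)%R ->
     'E_P[S1 t] = t%:E * (l1%:E * 'E_P[Y1 1%N] + l0%:E * 'E_P[Y3 1%N]) /\
     'E_P[S2 t] = t%:E * (l2%:E * 'E_P[Y2 1%N] + l0%:E * 'E_P[Y4 1%N]))%E /\
  (* (ii) *)
  (finite_second_moment -> forall t : R, (0 <= t)%R ->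
     'V_P[S1 t] = t%:E * (l1%:E * 'E_P[fun w => (Y1 1%N w ^+ 2)%R] +
                          l0%:E * 'E_P[fun w => (Y3 1%N w ^+ 2)%R]) /\
     'V_P[S2 t] = t%:E * (l2%:E * 'E_P[fun w => (Y2 1%N w ^+ 2)%R] +
                          l0%:E * 'E_P[fun w => (Y4 1%N w ^+ 2)%R]))%E /\
  (* (iii), in [0, +oo] *)
  (forall t : R, (0 <= t)%R ->
     'E_P[fun w => (S1 t w * S2 t w)%R] =
     t%:E * (l0%:E * 'E_P[fun w => (Y3 1%N w * Y4 1%N w)%R]) +
     (t ^+ 2)%:E *
       ((l1%:E * 'E_P[Y1 1%N] + l0%:E * 'E_P[Y3 1%N]) *
        (l2%:E * 'E_P[Y2 1%N] + l0%:E * 'E_P[Y4 1%N])))%E /\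
  (* (iv), under the condition of (i), so that the covariance is defined *)
  (finite_mean -> forall t : R, (0 <= t)%R ->
     covariance P (S1 t) (S2 t) =
     t%:E * (l0%:E * 'E_P[fun w => (Y3 1%N w * Y4 1%N w)%R]))%E /\
  (* (v) *)
  (finite_second_moment -> forall t : R, 0 < t ->
     correlation P (S1 t) (S2 t) =
     l0 * fine 'E_P[fun w => (Y3 1%N w * Y4 1%N w)%R] /
     Num.sqrt ((l1 * fine 'E_P[fun w => (Y1 1%N w ^+ 2)%R] +
                l0 * fine 'E_P[fun w => (Y3 1%N w ^+ 2)%R]) *
               (l2 * fine 'E_P[fun w => (Y2 1%N w ^+ 2)%R] +
                l0 * fine 'E_P[fun w => (Y4 1%N w ^+ 2)%R]))).
Proof.
move=> l S1 S2 finite_mean finite_second_moment.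
pose M := claim_counts N0 N1 N2; pose X := marks Y1 Y2 Y3 Y4.
pose rate t (k : 'I_3) : R :=
  match val k with 0 => l0 * t | 1 => l1 * t | _ => l2 * t end.
have S1E t : S1 t = compound_sum (M t) X fst.
  apply/funext => w; have [Y10 Y20 Y30 Y40] := Y_0 w.
  rewrite /S1 !random_sumE// /compound_sum !big_ord_recl big_ord0 /M /X /=.
  by rewrite [X in _ + (_ + (X + _))]big1// !addr0 addrC.
have S2E t : S2 t = compound_sum (M t) X snd.
  apply/funext => w; have [Y10 Y20 Y30 Y40] := Y_0 w.
  rewrite /S2 !random_sumE// /compound_sum !big_ord_recl big_ord0 /M /X /=.
  by rewrite [X in _ + (X + _)]big1// add0r addr0 addrC.
have G_meas := @measurable_model_generators _ _ _ P N0 N1 N2 Y1 Y2 Y3 Y4.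
have G_indep := model_independent indep.
have M_meas t : 0 <= t -> forall k n,
    <<s count_generators N0 N1 N2 k >> (M t k @^-1` [set n]).
  by move=> t0 k n; exact: measurable_claim_counts.
have rate_ge0 t : 0 <= t -> forall k, 0 <= rate t k.
  by move=> t0 [[|[|[|//]]] lt3]; rewrite mulr_ge0// ltW.
have M_law t : 0 <= t -> forall k n,
    P (M t k @^-1` [set n]) = (poisson_weight (rate t k) n)%:E.
  by move=> t0 [[|[|[|//]]] lt3] n; exact: poisson_process_marginal.
have X_meas := @measurable_marks _ _ _ P Y1 Y2 Y3 Y4.
have X_iid := marks_iid Y1_iid Y2_iid Y34_iid.
have X_fst k i : {ae P, forall w, 0 <= (X k i w).1}.
  by apply: filterS (Y_gt0 i) => w [? ? ? ?]; case: k => -[|[|[|//]]] lt3;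
    rewrite /X /marks /= ?lexx // ltW.
have X_snd k i : {ae P, forall w, 0 <= (X k i w).2}.
  by apply: filterS (Y_gt0 i) => w [? ? ? ?]; case: k => -[|[|[|//]]] lt3;
    rewrite /X /marks /= ?lexx // ltW.
have mfst : measurable_fun setT (fst : R * R -> R) by exact: measurable_fst.
have msnd : measurable_fun setT (snd : R * R -> R) by exact: measurable_snd.
have X_sum (F : R * R -> R) t :
  (\sum_(k < 3) ((rate t k)%:E * 'E_P[fun w => F (X k 0%N w)]) =
   (l0 * t)%:E * 'E_P[fun w => F (Y3 1%N w, Y4 1%N w)] +
   ((l1 * t)%:E * 'E_P[fun w => F (Y1 1%N w, 0)%R] +
    (l2 * t)%:E * 'E_P[fun w => F (0, Y2 1%N w)%R]))%E.
  by rewrite !big_ord_recl big_ord0 adde0.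
have Y_ge0 : [/\ 0 <= 'E_P[Y1 1%N], 0 <= 'E_P[Y2 1%N],
    0 <= 'E_P[Y3 1%N] & 0 <= 'E_P[Y4 1%N]]%E.
  by split; apply: ae_ge0_expectation_ge0 => //;
    apply: filterS (Y_gt0 0%N) => w [? ? ? ?]; exact: ltW.
have [EY1 EY2 EY3 EY4] := Y_ge0.
have E0 : ('E_P[fun=> 0%R] = 0)%E by exact: expectation_cst.
have combine (a b t : R) (x y : \bar R) : 0 <= a -> 0 <= b -> (0 <= x -> 0 <= y ->
    (a * t)%:E * x + (b * t)%:E * y = t%:E * (a%:E * x + b%:E * y))%E.
  move=> a0 b0 x0 y0; rewrite ge0_muleDr ?mule_ge0//.
  by rewrite ![(_ * t)%R]mulrC !EFinM !muleA.
have mean1 t : 0 <= t ->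
    ('E_P[S1 t] = t%:E * (l1%:E * 'E_P[Y1 1%N] + l0%:E * 'E_P[Y3 1%N]))%E.
  move=> t0; rewrite S1E.
  rewrite (ae_compound_poisson_mean G_meas G_indep (M_meas t t0) (rate_ge0 t t0)
    (M_law t t0) X_meas X_iid mfst X_fst).
  rewrite (X_sum fst)//= E0 mule0 adde0 addeC combine// ltW//.
have mean2 t : 0 <= t ->
    ('E_P[S2 t] = t%:E * (l2%:E * 'E_P[Y2 1%N] + l0%:E * 'E_P[Y4 1%N]))%E.
  move=> t0; rewrite S2E.
  rewrite (ae_compound_poisson_mean G_meas G_indep (M_meas t t0) (rate_ge0 t t0)
    (M_law t t0) X_meas X_iid msnd X_snd).
  rewrite (X_sum snd)//= E0 mule0 add0e addeC combine// ltW//.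
have mean_lty (a b t : R) (x y : \bar R) : 0 <= a -> 0 <= b -> 0 <= t ->
    (0 <= x -> 0 <= y -> x < +oo -> y < +oo ->
    t%:E * (a%:E * x + b%:E * y) < +oo)%E.
  move=> a0 b0 t0 x0 y0 xoo yoo.
  by rewrite !(lte_mul_pinfty, lte_add_pinfty) ?adde_ge0 ?mule_ge0.
have mean1_lty t : 0 <= t -> finite_mean -> ('E_P[S1 t] < +oo)%E.
  by move=> t0 [? ? ? ?]; rewrite mean1// mean_lty// ltW.
have mean2_lty t : 0 <= t -> finite_mean -> ('E_P[S2 t] < +oo)%E.
  by move=> t0 [? ? ? ?]; rewrite mean2// mean_lty// ltW.
have second_mean : finite_second_moment -> finite_mean.
  move=> [? ? ? ?]; split; apply: expectation_lty_sqr => //;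
    by apply: filterS (Y_gt0 0%N) => w [? ? ? ?]; exact: ltW.
have E0l (Z : T -> R) : ('E_P[fun w => (0 * Z w)%R] = 0)%E.
  by rewrite -[RHS]E0; congr expectation; apply/funext => w; rewrite mul0r.
have E0r (Z : T -> R) : ('E_P[fun w => (Z w * 0)%R] = 0)%E.
  by rewrite -[RHS]E0; congr expectation; apply/funext => w; rewrite mulr0.
(* only the marks of the common process have two nonzero coordinates *)
have EX12 t : (\sum_(k < 3) ((rate t k)%:E *
      'E_P[fun w => ((X k 0%N w).1 * (X k 0%N w).2)%R]) =
    t%:E * (l0%:E * 'E_P[fun w => (Y3 1%N w * Y4 1%N w)%R]))%E.
  by rewrite (X_sum (fun x => x.1 * x.2))/= E0l E0r !mule0 !adde0 mulrC EFinM muleA.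
have EX11 t : (\sum_(k < 3) ((rate t k)%:E *
      'E_P[fun w => ((X k 0%N w).1 * (X k 0%N w).1)%R]) =
    t%:E * (l1%:E * 'E_P[fun w => (Y1 1%N w ^+ 2)%R] +
            l0%:E * 'E_P[fun w => (Y3 1%N w ^+ 2)%R]))%E.
  rewrite (X_sum (fun x => x.1 ^+ 2))/= [in X in (_ + (_ + X))%E]expr2 E0l mule0 adde0 addeC.
  by rewrite combine ?(ltW l1_gt0) ?(ltW l0_gt0) ?expectation_ge0// => w; exact: sqr_ge0.
have EX22 t : (\sum_(k < 3) ((rate t k)%:E *
      'E_P[fun w => ((X k 0%N w).2 * (X k 0%N w).2)%R]) =
    t%:E * (l2%:E * 'E_P[fun w => (Y2 1%N w ^+ 2)%R] +
            l0%:E * 'E_P[fun w => (Y4 1%N w ^+ 2)%R]))%E.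
  rewrite (X_sum (fun x => x.2 ^+ 2))/= [in X in (_ + (X + _))%E]expr2 E0l mule0 add0e addeC.
  by rewrite combine ?(ltW l2_gt0) ?(ltW l0_gt0) ?expectation_ge0// => w; exact: sqr_ge0.
have cov t : 0 <= t -> finite_mean -> covariance P (S1 t) (S2 t) =
    (t%:E * (l0%:E * 'E_P[fun w => (Y3 1%N w * Y4 1%N w)%R]))%E.
  move=> t0 fm; have := mean1_lty t t0 fm; have := mean2_lty t t0 fm.
  rewrite S1E S2E => m2 m1; rewrite -EX12.
  exact: (ae_compound_poisson_covariance G_meas G_indep (M_meas t t0)
    (rate_ge0 t t0) (M_law t t0) X_meas X_iid mfst X_fst msnd X_snd).
have var1 t : 0 <= t -> finite_mean ->
    ('V_P[S1 t] = t%:E * (l1%:E * 'E_P[fun w => (Y1 1%N w ^+ 2)%R] +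
                          l0%:E * 'E_P[fun w => (Y3 1%N w ^+ 2)%R]))%E.
  move=> t0 /(mean1_lty t t0); rewrite S1E => m; rewrite -EX11.
  exact: (ae_compound_poisson_covariance G_meas G_indep (M_meas t t0)
    (rate_ge0 t t0) (M_law t t0) X_meas X_iid mfst X_fst mfst X_fst).
have var2 t : 0 <= t -> finite_mean ->
    ('V_P[S2 t] = t%:E * (l2%:E * 'E_P[fun w => (Y2 1%N w ^+ 2)%R] +
                          l0%:E * 'E_P[fun w => (Y4 1%N w ^+ 2)%R]))%E.
  move=> t0 /(mean2_lty t t0); rewrite S2E => m; rewrite -EX22.
  exact: (ae_compound_poisson_covariance G_meas G_indep (M_meas t t0)
    (rate_ge0 t t0) (M_law t t0) X_meas X_iid msnd X_snd msnd X_snd).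
split; last split; last split; last split; last split.
- move=> t z1 z2 t0 z10 z20.
  pose phi (x : R * R) := expR (- (z1 * x.1 + z2 * x.2)).
  have mphi : measurable_fun setT phi.
    do 2 apply: measurableT_comp => //.
    by apply: measurable_funD; exact: measurable_funM.
  have phi_ge0 x : 0 <= phi x by exact: expR_ge0.
  pose q k := fine 'E_P[fun w => phi (X k 0%N w)]%E.
  have Eq k : 'E_P[fun w => phi (X k 0%N w)]%E = (q k)%:E.
    rewrite fineK// expectation_fin_num_le1//.
      apply: measurableT_comp => //.
      exact: (measurable_fun_sub_sigma (@G_meas (inr k)) (@X_meas k 0%N)).
    apply: filterS2 (X_fst k 0%N) (X_snd k 0%N) => w x0 y0.
    by rewrite /phi -expR0 ler_expR oppr_le0 addr_ge0// mulr_ge0.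
  transitivity ('E_P[fun w => (\prod_k \prod_(i < M t k w) phi (X k i w))%R]%E).
    congr expectation; apply/funext => w; rewrite S1E S2E.
    under [RHS]eq_bigr do rewrite -expR_sum sumrN big_split/= -!mulr_sumr.
    by rewrite -expR_sum sumrN big_split/= -!mulr_sumr opprD mulNr.
  rewrite (compound_poisson_laplace G_meas G_indep (M_meas t t0)
    (rate_ge0 t t0) (M_law t t0) X_meas X_iid mphi phi_ge0 Eq).
  have <- : q (lift ord0 ord0) = fine 'E_P[fun w => expR (- z1 * Y1 1%N w)%R]%E.
    congr (fine (expectation P _)); apply/funext => w.
    by rewrite /phi /= mulr0 addr0 mulNr.
  have <- : q (lift ord0 (lift ord0 ord0)) =
      fine 'E_P[fun w => expR (- z2 * Y2 1%N w)%R]%E.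
    congr (fine (expectation P _)); apply/funext => w.
    by rewrite /phi /= mulr0 add0r mulNr.
  have -> : fine 'E_P[fun w => expR (- (z1 * Y3 1%N w + z2 * Y4 1%N w))%R]%E =
    q ord0 by [].
  congr (expR _)%:E.
  rewrite !big_ord_recl big_ord0 /rate /= /l.
  have l_neq0 : l0 + l1 + l2 != 0 by rewrite gt_eqF// !addr_gt0.
  by field.
- by move=> fm t t0; split; [exact: mean1|exact: mean2].
- by move=> /second_mean fm t t0; split; [exact: var1|exact: var2].
- move=> t t0.
  rewrite S1E S2E.
  rewrite (ae_compound_poisson_moment G_meas G_indep (M_meas t t0) (rate_ge0 t t0)
    (M_law t t0) X_meas X_iid mfst X_fst msnd X_snd).
  by rewrite EX12 -S1E -S2E mean1// mean2// expr2 EFinM muleACA.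
- by move=> fm t t0; exact: cov.
- move=> fm2 t t0; have fm := second_mean fm2.
  move: fm2 => [? ? ? ?].
  have fineD (a b : R) (x y : \bar R) : (0 <= x)%E -> (0 <= y)%E ->
      (x < +oo)%E -> (y < +oo)%E ->
      fine (a%:E * x + b%:E * y)%E = a * fine x + b * fine y.
    move=> x0 y0 xoo yoo.
    by rewrite fineD ?fineM ?fin_numM// ge0_fin_numE.
  have E2 (Z : T -> R) : (0 <= 'E_P[fun w => (Z w ^+ 2)%R])%E.
    by apply: expectation_ge0 => w; exact: sqr_ge0.
  rewrite /correlation cov ?var1 ?var2 ?(ltW t0)// !fine_pmulr// !fineD//.
  rewrite mulrACA -expr2 sqrtrM ?sqr_ge0// sqrtr_sqr gtr0_norm//.
  by rewrite -mulf_div divff ?mul1r// gt_eqF.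
Qed.
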